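(* Consider the constrained multi-objective problem (MOP) described in the context and apply to it the trust-region filter algorithm described in the context, and suppose that the assumptions (A1)–(A8) listed there hold. Let $\{x^{(k)}\}$ be the sequence of iterates produced by the algorithm. Then either the restoration procedure in step 2 terminates unsuccessfully by converging to an infeasible, first-order critical point of the problem $\min_x \theta(x)$, or there is a subsequence $\{k_\ell\}$ of indices for which $\lim_{\ell\to\infty} x^{(k_\ell)} = \bar x$ and $\bar x$ is quasi-stationary, i.e. $$\theta(\bar x) = \lim_{\ell\to\infty}\theta_{k_\ell} = 0 \quad\text{and}\quad \lim_{\ell\to\infty}\chi^{(k_\ell)} = 0,$$ and for which it also holds that $\lim_{\ell\to\infty}\Delta_{(k_\ell)} = 0$.
   Context: **Problem.** Let $f=(f_1,\dots,f_K):\mathbb{R}^n\to\mathbb{R}^K$, $h=(h_1,\dots,h_M):\mathbb{R}^n\to\mathbb{R}^M$, $g=(g_1,\dots,g_P):\mathbb{R}^n\to\mathbb{R}^P$ be twice continuously differentiable. (MOP) is: $\min_x f(x)$ (in the Pareto sense) subject to $h(x)=0$, $g(x)\le 0$. Put $\Phi(x)=\max_{\ell} f_\ell(x)$ and the infeasibility measure $\theta(x)=\max\{0,\max_\ell|h_\ell(x)|,\max_\ell g_\ell(x)\}$; write $\theta_k=\theta(x^{(k)})$. **Models, trust regions, subproblems.** In iteration $k$ there are norms $\|\cdot\|_{\mathrm{tr},k}$ (trust-region norm) and $\|\cdot\|_k$ (problem norm) on $\mathbb{R}^n$, a preliminary radius $\bar\Delta_{(k)}$ and a radius $\Delta_{(k)}\le\bar\Delta_{(k)}$;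 $B(x^{(k)};\Delta)=\{x:\|x-x^{(k)}\|_{\mathrm{tr},k}\le\Delta\}$, $B^{(k)}=B(x^{(k)};\Delta_{(k)})$, and $\mathcal C=\bigcup_{k}B(x^{(k)};\bar\Delta_{(k)})$. Surrogate models $\hat f^{(k)},\hat g^{(k)},\hat h^{(k)}$ of $f,g,h$ are used, with $\Phi^{(k)}(x)=\max_\ell\hat f^{(k)}_\ell(x)$ and Jacobians $\hat F_k,\hat G_k,\hat H_k$. The approximate linearized feasible set is $$\mathcal L_k=\{x^{(k)}+s:\ \hat h^{(k)}(x^{(k)})+\hat H_k(x^{(k)})s=0,\ \hat g^{(k)}(x^{(k)})+\hat G_k(x^{(k)})s\le 0\}.$$ The normal step $n^{(k)}$ is the minimizer of $\|n\|_2^2$ subject to $n\in\mathcal L_k-x^{(k)}$; $x^{(k)}_{\mathrm n}=x^{(k)}+n^{(k)}$. With constants $c_\Delta\in(0,1)$, $c_\mu>0$, $\mu\in(0,1)$, a normal step $n$ is *compatible* for a radius $\Delta$ if $\|n\|_{\mathrm{tr},k}\le c_\Delta\Delta\min\{1,c_\mu\Delta^\mu\}$; ''$n^{(k)}$ is compatible'' without further mention refers to the radius $\bar\Delta_{(k)}$. The tangential problem is $$\omega(x_{\mathrm n}^{(k)};\hat f^{(k)},\mathcal L_k,\|\cdot\|)=-\min_{\beta\in\mathbb R,\,d\in\mathbb R^n}\beta\ \text{ s.t. }\ \hat F_k(x_{\mathrm n}^{(k)})d\le\beta\ (\text{componentwise}),\ d\in\mathcal L_k-x_{\mathrm n}^{(k)},\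 \|d\|\le1 .$$ Its value for $\|\cdot\|=\|\cdot\|_k$ is $\hat\omega^{(k)}$ and for $\|\cdot\|=\|\cdot\|_2$ it is $\hat\omega^{(k)}_2$. The (inexact) criticality measure is $\min\{1,\hat\omega^{(k)}\}$; its preliminary value, before the Criticality Routine, is denoted $\bar\chi^{(k)}$, and its final value is denoted $\chi^{(k)}$. **Filter.** A filter $\mathcal F$ is a discrete set of pairs $(\theta_j,\Phi_j)$; with a fixed constant $\gamma_\theta\in(0,1)$, a point $x$ is acceptable for $\mathcal F$ iff for all $(\theta_j,\Phi_j)\in\mathcal F$: $\theta(x)\le(1-\gamma_\theta)\theta_j$ or $\Phi(x)\le\Phi_j-\gamma_\theta\theta_j$. Adding $x$ to the filter means adding $(\theta(x),\Phi(x))$ and removing all pairs with $\theta_j\ge\theta(x)$ and $\Phi_j-\gamma_\theta\theta_j\ge\Phi(x)-\gamma_\theta\theta(x)$. **Parameters.** $0<\Delta_{(0)}\le\Delta_{\max}<\infty$; $0<\gamma_0\le\gamma_1<1\le\gamma_2$; $0<\nu_1\le\nu_0<1$; $0<\varepsilon_\chi<1$; $0\le\varepsilon_\theta\le\delta_{\mathrm n}$ (with $\delta_{\mathrm n}$ from (A4)); $\kappa_\theta\in(0,1)$; $\psi>\frac1{1+\mu}$; $0<\mathtt B<\mathtt M$; $\alpha\in(0,1)$. **Algorithm.** Step 0: $k=0$, $\mathcal F=\emptyset$, $n^{(0)}=$ undefined, $\bar\Delta_{(0)}:=\Delta_{(0)}$; build models fully linear on $B(x^{(0)};\bar\Delta_{(0)})$.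 Step 1 (compatibility test): if $n^{(k)}$ is undefined, try to compute it. If $n^{(k)}$ exists and is compatible for $\bar\Delta_{(k)}$, go to step 3; otherwise go to step 2. Step 2 (restoration): add $x^{(k)}$ to $\mathcal F$, set $\Delta_{(k)}\leftarrow\bar\Delta_{(k)}$, $\chi^{(k)}\leftarrow\bar\chi^{(k)}$, and attempt to find a restoration step $r^{(k)}$ and $\bar\Delta_{(k+1)}>0$ such that the normal step at $x^{(k)}+r^{(k)}$ is compatible for $\bar\Delta_{(k+1)}$ and $x^{(k)}+r^{(k)}$ is acceptable for $\mathcal F$; set $x^{(k+1)}=x^{(k)}+r^{(k)}$ and go to step 8. (The restoration step aims at reducing the constraint violation and is usually calculated by solving $\min_x\theta(x)$.) Step 3: compute a minimizer $d^{(k)}$ of the tangential problem with norm $\|\cdot\|_k$, and $\bar\chi^{(k)}$. Step 4 (criticality test): if $\theta_k<\varepsilon_\theta$, $\bar\chi^{(k)}<\varepsilon_\chi$ and $\bar\Delta_{(k)}>\mathtt M\bar\chi^{(k)}$, run the Criticality Routine (below) to obtain $\Delta_{(k)},\chi^{(k)}$ and update the models, $n^{(k)}$ and $d^{(k)}$. Else set $\Delta_{(k)}=\bar\Delta_{(k)}$, $\chi^{(k)}=\bar\chi^{(k)}$. Step 5 (acceptance test): compute a step size $\sigma_{(k)}$ as in (A7) and put $s^{(k)}=n^{(k)}+\sigma_{(k)}d^{(k)}$, $x_{\mathrm s}^{(k)}=x^{(k)}+s^{(k)}$, $\rho^{(k)}=\frac{\Phi(x^{(k)})-\Phi(x_{\mathrm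 s}^{(k)})}{\Phi^{(k)}(x^{(k)})-\Phi^{(k)}(x_{\mathrm s}^{(k)})}$. If $x_{\mathrm s}^{(k)}$ is not acceptable for $\mathcal F\cup\{(\theta_k,\Phi(x^{(k)}))\}$, or if both $$(\ast)\quad\Phi^{(k)}(x^{(k)})-\Phi^{(k)}(x_{\mathrm s}^{(k)})\ge\kappa_\theta\theta_k^\psi$$ and $\rho^{(k)}<\nu_1$ hold, then set $x^{(k+1)}=x^{(k)}$, $n^{(k+1)}=n^{(k)}$, choose $\bar\Delta_{(k+1)}\in[\gamma_0\Delta_{(k)},\gamma_1\Delta_{(k)}]$ and go to step 8. Step 6 (filter test): if $(\ast)$ fails, add $x^{(k)}$ to $\mathcal F$. Step 7: set $x^{(k+1)}=x_{\mathrm s}^{(k)}$ and choose $\bar\Delta_{(k+1)}\in[\gamma_0\Delta_{(k)},\gamma_1\Delta_{(k)}]$ if $\rho^{(k)}<\nu_0$ and $\bar\Delta_{(k+1)}\in[\Delta_{(k)},\min\{\gamma_2\Delta_{(k)},\Delta_{\max}\}]$ if $\rho^{(k)}\ge\nu_0$. Step 8: update the models for $x^{(k+1)}$ and $\bar\Delta_{(k+1)}$; if the models depend on the trust-region radius, set $n^{(k+1)}$ to undefined (it is also undefined whenever it was not assigned in step 5); $k\leftarrow k+1$; go to step 1. **Criticality Routine** (at $x^{(k)}$). Start with $j=0$, $\delta_0=\bar\Delta_{(k)}$, $\chi_0=\bar\chi^{(k)}$, $n_0=n^{(k)}$. While $\delta_j>\mathtt M\chi_j$: let $\delta_j^+=\alpha\delta_j$;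 make the models fully linear for radius $\delta_j^+$; compute the normal step $n_j^+$ for the new models; if $n_j^+$ is not compatible for $\delta_j^+$, break; otherwise $j\leftarrow j+1$, $\delta_j=\delta_{j-1}^+$, $n_j=n_{j-1}^+$, and solve the tangential problem for the new models to get the criticality measure $\chi_j$. After the loop, keep the updated models, set $\chi^{(k)}=\chi_j$, $n^{(k)}=n_j$ and $\Delta_{(k)}=\min\{\max\{\delta_j,\mathtt B\chi^{(k)}\},\bar\Delta_{(k)}\}$. **Convention.** If in some iteration $k$ the Criticality Routine runs infinitely, the sequence considered in the claim is the inner sequence $j\to\infty$ with constant point $x^{(k)}$, radii $\delta_j$ and measures $\chi_j$. **Assumptions.** (A1) There is $0<\Delta_{\max}<\infty$ such that for all $k$: $0<\Delta_{(k)}\le\bar\Delta_{(k)}<\Delta_{\max}$, and all functions (the true ones and their models) are defined on $\mathcal C$. (A2) All $f_\ell,g_\ell,h_\ell$ are twice continuously differentiable on an open domain containing $\mathcal C$ and have Lipschitz continuous gradients on $\mathcal C$. (A3) A model $\hat\varphi$ of a scalar function $\varphi$ is *fully linear* on $B(x;\Delta)$ with constants $\mathtt e,\dot{\mathtt e},L>0$ if $\nabla\hat\varphi$ is Lipschitz continuous with constant at most $L$ and, for all $\xi\in B(x;\Delta)\cap\mathcal C$, $\|\nabla\varphi(\xi)-\nabla\hat\varphi(\xi)\|_2\le\dot{\mathtt e}\Delta$ and $|\varphi(\xi)-\hat\varphi(\xi)|\le\mathtt e\Delta^2$; a vector of models is fully linear if all its components are. The models come from classes that contain, with constants $\mathtt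 e,\dot{\mathtt e},L$ independent of $x\in\mathcal C$ and $\Delta\in(0,\Delta_{\max}]$, a fully linear model on every $B(x;\Delta)$, and for which there is an algorithm that, in a finite, uniformly bounded number of steps, establishes that a given model is fully linear on $B(x;\Delta)$ or finds one that is. For every $k$ the models $\hat f^{(k)},\hat g^{(k)},\hat h^{(k)}$ are fully linear on $B(x^{(k)};\Delta_{(k)})$ in this sense, with constants chosen so large that $L+L^{\varphi}\le\mathtt e$ and $\dot{\mathtt e}/2\le\mathtt e$ hold globally, where $L^\varphi$ is a Lipschitz constant of $\nabla\varphi$. All models interpolate at $x^{(k)}$, i.e. $\hat\varphi(x^{(k)})=\varphi(x^{(k)})$. (A4) There are constants $\delta_{\mathrm n}>0$, $c_{\mathrm{ubn}}>0$ such that if $\theta_k\le\delta_{\mathrm n}$, then $n^{(k)}$ exists and $\|n^{(k)}\|_{\mathrm{tr},k}\le c_{\mathrm{ubn}}\theta_k$. (A5) There is $\mathsf c\ge1$ such that for all $k$, all $x\in\mathbb R^n$ and $\|\cdot\|_*\in\{\|\cdot\|_{\mathrm{tr},k},\|\cdot\|_k\}$: $\frac1{\mathsf c}\|x\|_*\le\|x\|_2\le\mathsf c\|x\|_*$. (A6) There is $\mathtt H>0$ such that for all $k$, $\ell$ and all $\xi\in\mathcal L_k\cap B^{(k)}$, the Hessian of $\hat f^{(k)}_\ell$ satisfies $\|\nabla^2\hat f^{(k)}_\ell(\xi)\|_2\le\mathtt H$. (A7) There are constants $c_{\mathrm{sd}}\in(0,1)$, $\mathtt W\ge1$ such that, if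 $\Delta_{(k)}\in(0,\Delta_{\max})$, $n^{(k)}$ is compatible and $d^{(k)}$ is a minimizer of the tangential problem with norm $\|\cdot\|_k$, there is (and the algorithm uses) a step length $\sigma_{(k)}\ge0$ with $x_{\mathrm n}^{(k)}+\sigma_{(k)}d^{(k)}\in\mathcal L_k\cap B^{(k)}$ and $\Phi^{(k)}(x_{\mathrm n}^{(k)})-\Phi^{(k)}(x_{\mathrm n}^{(k)}+\sigma_{(k)}d^{(k)})\ge c_{\mathrm{sd}}\,\hat\omega_2^{(k)}\min\{\hat\omega_2^{(k)}/\mathtt W,\Delta_{(k)},1\}$. (A8) $\mathcal C$ is contained in a closed and bounded set.
   Formalization: The limit of the radii is claimed only if ε_θ>0 (it can fail for ε_θ=0); a failing restoration is assumed to converge to an infeasible first-order critical point of θ; (A4) is read as covering every normal step computed in iteration k, including Criticality Routine trials. *)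

(* Defs.v *)
From mathcomp Require Export all_boot all_order all_algebra.
From mathcomp Require Export all_classical all_reals all_analysis.
Set Implicit Arguments.
Unset Strict Implicit.
Unset Printing Implicit Defensive.
Import Order.TTheory GRing.Theory Num.Theory.
Import numFieldNormedType.Exports.
Local Open Scope classical_set_scope.
Local Open Scope ring_scope.

Section Calculus.
Context {R : realType} {n : nat}.
Local Notation V := 'rV[R]_n.

(* The library norm on 'rV[R]_n is the maximum norm. *)
Definition norm2 (v : V) : R := Num.sqrt (\sum_i v 0 i ^+ 2).

Definition is_norm (N : V -> R) : Prop :=
  [/\ forall x y, N (x + y) <= N x + N y,
      forall a x, N (a *: x) = `|a| * N x
    & forall x, N x = 0 -> x = 0].

Definition nball (N : V -> R) (x : V) (r : R) : set V :=
  [set y | N (y - x) <= r].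

Definition grad (phi : V -> R) (x : V) : V :=
  \row_i 'D_(delta_mx 0 i) phi x.

Definition hessian (phi : V -> R) : V -> 'M[R]_n := jacobian (grad phi).

Definition C2_on (U : set V) (phi : V -> R) : Prop :=
  forall x, U x -> [/\ differentiable phi x, differentiable (grad phi) x
                     & {for x, continuous (hessian phi)}].

Definition opnorm2 (A : 'M[R]_n) : R :=
  sup [set norm2 (v *m A) | v in [set v | norm2 v <= 1]].

Definition lip_grad (D : set V) (L : R) (phi : V -> R) : Prop :=
  forall x y, D x -> D y -> norm2 (grad phi x - grad phi y) <= L * norm2 (x - y).

(* First-order criticality for the unconstrained minimization of a            *)
(* nonsmooth phi: all one-sided directional derivatives exist and are         *)
(* nonnegative.                                                               *)
Definition first_order_critical (phi : V -> R) (x : V) : Prop :=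
  forall d : V, exists2 l : R,
    t^-1 * (phi (x + t *: d) - phi x) @[t --> 0^'+] --> l & 0 <= l.

End Calculus.

Section Problem.
Context {R : realType} {n K M P : nat}.
Local Notation V := 'rV[R]_n.

(* K.+1 objectives (at least one), M equality and P inequality constraints.   *)
(* The same record is used for the problem itself and for its models.           *)
Record mop := Mop {
  obj  : V -> 'rV[R]_K.+1;
  eqc  : V -> 'rV[R]_M;
  ineq : V -> 'rV[R]_P }.

Definition comp_index : Type := ('I_K.+1 + 'I_M + 'I_P)%type.

Definition component (p : mop) (i : comp_index) : V -> R := fun x =>
  match i with
  | inl (inl l) => obj p x 0 l
  | inl (inr l) => eqc p x 0 l
  | inr l => ineq p x 0 l
  end.

Definition Phi (p : mop) (x : V) : R :=
  \big[Num.max/obj p x 0 ord0]_l obj p x 0 l.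

Definition theta (p : mop) (x : V) : R :=
  Num.max (\big[Num.max/0]_l `|eqc p x 0 l|) (\big[Num.max/0]_l ineq p x 0 l).

(* 'J F x acts on row vectors from the right, so F'(x) s is s *m 'J F x.      *)
Definition lin_set (m : mop) (x : V) : set V := [set y |
  eqc m x + (y - x) *m 'J (eqc m) x = 0 /\
  forall l, (ineq m x + (y - x) *m 'J (ineq m) x) 0 l <= 0].

Definition normal_step (m : mop) (x v : V) : Prop :=
  lin_set m x (x + v) /\
  forall w, lin_set m x (x + w) -> norm2 v ^+ 2 <= norm2 w ^+ 2.

Definition tan_feasible (m : mop) (x xn : V) (N : V -> R) (b : R) (d : V) :=
  [/\ forall l, (d *m 'J (obj m) xn) 0 l <= b, lin_set m x (xn + d) & N d <= 1].

Definition tan_minimizer (m : mop) (x xn : V) (N : V -> R) (d : V) : Prop :=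
  exists2 b, tan_feasible m x xn N b d &
    forall b' d', tan_feasible m x xn N b' d' -> b <= b'.

Definition omega (m : mop) (x xn : V) (N : V -> R) : R :=
  - inf [set b | exists d, tan_feasible m x xn N b d].

Definition crit_measure (m : mop) (x xn : V) (N : V -> R) : R :=
  Num.min 1 (omega m x xn N).

End Problem.
Arguments mop : clear implicits.
Arguments comp_index : clear implicits.

Record params (R : realType) := Params {
  Delta0 : R; Delta_max : R;
  gamma0 : R; gamma1 : R; gamma2 : R;
  nu0 : R; nu1 : R;
  eps_chi : R; eps_theta : R;
  kappa_theta : R; psi : R;
  cB : R; cM : R; alpha : R;
  gamma_theta : R;
  c_Delta : R; c_mu : R; mu : R }.

Definition valid_params (R : realType) (c : params R) (delta_n : R) : Prop :=
  [/\ 0 < Delta0 c <= Delta_max c,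
      [/\ 0 < gamma0 c, gamma0 c <= gamma1 c, gamma1 c < 1 & 1 <= gamma2 c],
      [/\ 0 < nu1 c, nu1 c <= nu0 c & nu0 c < 1],
      [/\ 0 < eps_chi c < 1 & 0 <= eps_theta c <= delta_n]
    & [/\ 0 < kappa_theta c < 1 & (1 + mu c)^-1 < psi c] /\
      [/\ 0 < cB c < cM c, 0 < alpha c < 1, 0 < gamma_theta c < 1,
          0 < c_Delta c < 1 & 0 < c_mu c /\ 0 < mu c < 1]].

Section Algorithm.
Context {R : realType} {n K M P : nat}.
Local Notation V := 'rV[R]_n.

(* fl_val, fl_grad, fl_lip are the constants of full linearity, norm_tr k and *)
(* norm_pb k the trust-region and problem norms of iteration k.               *)
Record setting := Setting {
  prob : mop R n K M P;
  par : params R;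
  model_class : comp_index K M P -> set (V -> R);
  fl_val : R; fl_grad : R; fl_lip : R;
  norm_tr : nat -> V -> R;
  norm_pb : nat -> V -> R }.

(* RestorationFails k y: the restoration attempt of iteration k generates the *)
(* points y 0, y 1, ... without ever returning a restoration step.            *)
Variant outcome :=
  | RunsForever
  | RestorationFails of nat & (nat -> V)
  | EndlessRoutine of nat.

(* The quantities of iteration k that the Criticality Routine recomputes are  *)
(* indexed by its counter j. Index 0 holds the preliminary values (rads k 0   *)
(* and chis k 0 are the preliminary radius and measure) and index len k the   *)
(* final ones; len k = 0 if the routine is not run. If the routine leaves its *)
(* loop by a break, the models that admit no compatible normal step sit at    *)
(* index (len k).+1. rad k is the final radius. Entries that the execution    *)
(* does not reach are irrelevant.                                             *)
Record run := Run {
  result : outcome;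
  pt : nat -> V;
  filter_at : nat -> seq (R * R);
  mods : nat -> nat -> mop R n K M P;
  rads : nat -> nat -> R;
  nsteps : nat -> nat -> V;
  dirs : nat -> nat -> V;
  chis : nat -> nat -> R;
  len : nat -> nat;
  rad : nat -> R;
  sigma : nat -> R }.

Variables (S : setting) (r : run).
Local Notation c := (par S).
Local Notation x := (pt r).

Definition reached (k : nat) : Prop :=
  match result r with
  | RunsForever => True
  | RestorationFails k0 _ | EndlessRoutine k0 => (k <= k0)%N
  end.

Definition completed (k : nat) : Prop :=
  match result r with
  | RunsForever => True
  | RestorationFails k0 _ | EndlessRoutine k0 => (k < k0)%N
  end.

Definition mod_ k := mods r k (len r k).
Definition nstep k := nsteps r k (len r k).
Definition dir k := dirs r k (len r k).
Definition chi k := chis r k (len r k).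
Definition xn k := x k + nstep k.
Definition xs k := xn k + sigma r k *: dir k.

Definition theta_at k := theta (prob S) (x k).
Definition Phi_at k := Phi (prob S) (x k).

Definition ball_at k (rho : R) : set V := nball (norm_tr S k) (x k) rho.

Definition domC : set V := \bigcup_(k in reached) ball_at k (rads r k 0).

Definition fully_linear k (phi m : V -> R) (y : V) (Delta : R) : Prop :=
  [/\ forall xi, domC xi -> differentiable m xi,
      lip_grad domC (fl_lip S) m
    & forall xi, (nball (norm_tr S k) y Delta `&` domC) xi ->
        norm2 (grad phi xi - grad m xi) <= fl_grad S * Delta /\
        `|phi xi - m xi| <= fl_val S * Delta ^+ 2].

Definition fully_linear_mop k (m : mop R n K M P) (Delta : R) : Prop :=
  forall i, fully_linear k (component (prob S) i) (component m i) (x k) Delta.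

Definition compatible k (v : V) (Delta : R) : Prop :=
  norm_tr S k v
    <= c_Delta c * Delta * Num.min 1 (c_mu c * Delta `^ mu c).

Definition has_compatible k j : Prop :=
  exists2 v, normal_step (mods r k j) (x k) v & compatible k v (rads r k j).

Definition acceptable (y : V) (F : seq (R * R)) : bool :=
  all (fun p => (theta (prob S) y <= (1 - gamma_theta c) * p.1)
             || (Phi (prob S) y <= p.2 - gamma_theta c * p.1)) F.

Definition filter_add (y : V) (F : seq (R * R)) : seq (R * R) :=
  let t := theta (prob S) y in let f := Phi (prob S) y in
  (t, f) :: [seq p <- F | ~~ ((t <= p.1)
      && (f - gamma_theta c * t <= p.2 - gamma_theta c * p.1))].

Definition computed k j : Prop :=
  let m := mods r k j in let y := x k + nsteps r k j in
  [/\ normal_step m (x k) (nsteps r k j),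
      compatible k (nsteps r k j) (rads r k j),
      tan_minimizer m (x k) y (norm_pb S k) (dirs r k j)
    & chis r k j = crit_measure m (x k) y (norm_pb S k)].

Definition crit_test k : bool :=
  [&& theta_at k < eps_theta c, chis r k 0 < eps_chi c
    & cM c * chis r k 0 < rads r k 0].

(* The loop body with counter j is entered, up to the compatibility check. *)
Definition routine_pass k j : Prop :=
  [/\ cM c * chis r k j < rads r k j,
      rads r k j.+1 = alpha c * rads r k j
    & fully_linear_mop k (mods r k j.+1) (rads r k j.+1)].

Definition routine_terminates k : Prop :=
  [/\ forall j, (j < len r k)%N -> routine_pass k j /\ computed k j.+1,
      rads r k (len r k) <= cM c * chi k \/
        (routine_pass k (len r k) /\ ~ has_compatible k (len r k).+1)
    & rad r k =
        Num.min (Num.max (rads r k (len r k)) (cB c * chi k)) (rads r k 0)].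

Definition routine_endless k : Prop :=
  forall j, routine_pass k j /\ computed k j.+1.

(* mods k j is constructed during the execution. *)
Definition built k j : Prop :=
  if j is i.+1 then
    result r = EndlessRoutine k \/
    [/\ completed k, has_compatible k 0, crit_test k
      & (i < len r k)%N \/ (i = len r k /\ cM c * chi k < rads r k i)]
  else reached k.

Definition model_decrease k : R := Phi (mod_ k) (x k) - Phi (mod_ k) (xs k).

Definition rho k : R := (Phi_at k - Phi (prob S) (xs k)) / model_decrease k.

Definition sufficient_decrease k : bool :=
  kappa_theta c * theta_at k `^ psi c <= model_decrease k.

Definition rejected k : bool :=
  ~~ acceptable (xs k) ((theta_at k, Phi_at k) :: filter_at r k)
  || (sufficient_decrease k && (rho k < nu1 c)).

Definition shrunk k : Prop :=
  gamma0 c * rad r k <= rads r k.+1 0 <= gamma1 c * rad r k.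

Definition enlarged k : Prop :=
  rad r k <= rads r k.+1 0 <= Num.min (gamma2 c * rad r k) (Delta_max c).

Definition criticality_step k : Prop :=
  if crit_test k then routine_terminates k
  else len r k = 0%N /\ rad r k = rads r k 0.

Definition acceptance_step k : Prop :=
  if rejected k then
    [/\ x k.+1 = x k, filter_at r k.+1 = filter_at r k & shrunk k]
  else
    [/\ x k.+1 = xs k,
        filter_at r k.+1 =
          if sufficient_decrease k then filter_at r k
          else filter_add (x k) (filter_at r k)
      & if rho k < nu0 c then shrunk k else enlarged k].

(* The preliminary measure of a restoration iteration is meaningful only if   *)
(* the (incompatible) normal step exists.                                     *)
Definition restoration_step k : Prop :=
  [/\ len r k = 0%N, rad r k = rads r k 0,
      forall v, normal_step (mods r k 0) (x k) v ->
        chis r k 0 = crit_measure (mods r k 0) (x k) (x k + v) (norm_pb S k),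
      filter_at r k.+1 = filter_add (x k) (filter_at r k)
    & [/\ 0 < rads r k.+1 0, has_compatible k.+1 0
        & acceptable (x k.+1) (filter_at r k.+1)]].

Definition iteration k : Prop :=
  (has_compatible k 0 ->
     [/\ computed k 0, criticality_step k & acceptance_step k]) /\
  (~ has_compatible k 0 -> restoration_step k).

Definition valid_run : Prop :=
  [/\ rads r 0 0 = Delta0 c,
      filter_at r 0 = [::],
      forall k, reached k -> fully_linear_mop k (mods r k 0) (rads r k 0),
      forall k, completed k -> iteration k
    & match result r with
      | RunsForever => True
      | RestorationFails k _ => ~ has_compatible k 0
      | EndlessRoutine k =>
          [/\ has_compatible k 0, computed k 0, crit_test k & routine_endless k]
      end].

Definition smooth_problem : Prop :=
  forall i, C2_on setT (component (prob S) i).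

Definition A1 : Prop :=
  [/\ 0 < Delta_max c,
      forall k, reached k -> 0 < rads r k 0 < Delta_max c
    & forall k, completed k -> 0 < rad r k <= rads r k 0].

Definition A2 : Prop :=
  (exists U : set V, [/\ open U, domC `<=` U
     & forall i, C2_on U (component (prob S) i)]) /\
  forall i, exists2 Lphi, 0 < Lphi & lip_grad domC Lphi (component (prob S) i).

Definition fully_linear_classes : Prop :=
  (forall k i y (Delta : R), reached k -> domC y -> 0 < Delta <= Delta_max c ->
     exists2 m, model_class S i m
              & fully_linear k (component (prob S) i) m y Delta) /\
  exists N
    (improve : nat -> comp_index K M P -> V -> R -> (V -> R) -> (V -> R)),
    forall k i y (Delta : R) m, reached k -> domC y ->
      0 < Delta <= Delta_max c ->
      model_class S i m -> exists2 j, (j <= N)%N &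
        let m' := iter j (improve k i y Delta) m in
        model_class S i m' /\ fully_linear k (component (prob S) i) m' y Delta.

Definition A3 : Prop :=
  [/\ [/\ 0 < fl_val S, 0 < fl_grad S & 0 < fl_lip S],
      fully_linear_classes,
      forall k, completed k -> fully_linear_mop k (mod_ k) (rad r k),
      fl_grad S / 2 <= fl_val S /\
      forall i, exists Lphi, [/\ 0 < Lphi,
        lip_grad domC Lphi (component (prob S) i) & fl_lip S + Lphi <= fl_val S]
    & forall k j i, built k j ->
        model_class S i (component (mods r k j) i) /\
        component (mods r k j) i (x k) = component (prob S) i (x k)].

(* All models built at x k are covered, i.e. every normal step that the       *)
(* algorithm tries to compute in iteration k.                                 *)
Definition A4 (delta_n : R) : Prop :=
  0 < delta_n /\ exists2 c_ubn, 0 < c_ubn &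
    forall k j, built k j -> theta_at k <= delta_n ->
      exists2 v, normal_step (mods r k j) (x k) v
               & norm_tr S k v <= c_ubn * theta_at k.

Definition A5 : Prop := exists2 cc, 1 <= cc &
  forall k N, N = norm_tr S k \/ N = norm_pb S k ->
    forall y : V, cc^-1 * N y <= norm2 y <= cc * N y.

Definition A6 : Prop := exists2 H, 0 < H &
  forall k (l : 'I_K.+1) xi, completed k ->
    (lin_set (mod_ k) (x k) `&` ball_at k (rad r k)) xi ->
    let phi := component (mod_ k) (inl (inl l)) in
    differentiable (grad phi) xi /\ opnorm2 (hessian phi xi) <= H.

Definition A7 : Prop := exists (c_sd W : R), [/\ 0 < c_sd < 1, 1 <= W &
  forall k, completed k -> has_compatible k 0 ->
    0 < rad r k < Delta_max c ->
    compatible k (nstep k) (rads r k 0) ->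
    tan_minimizer (mod_ k) (x k) (xn k) (norm_pb S k) (dir k) ->
    let omega2 := omega (mod_ k) (x k) (xn k) norm2 in
    [/\ 0 <= sigma r k,
        (lin_set (mod_ k) (x k) `&` ball_at k (rad r k))
          (xn k + sigma r k *: dir k)
      & c_sd * omega2 * Num.min (omega2 / W) (Num.min (rad r k) 1)
        <= Phi (mod_ k) (xn k) - Phi (mod_ k) (xn k + sigma r k *: dir k)]].

Definition A8 : Prop :=
  exists D : set V, [/\ closed D, bounded_set D & domC `<=` D].

Definition infeasible_critical_limit (y : nat -> V) : Prop :=
  exists xbar : V, [/\ y @ \oo --> xbar, 0 < theta (prob S) xbar
                     & first_order_critical (theta (prob S)) xbar].

(* The restoration procedure is a solver for the minimization of theta: it    *)
(* either returns a restoration step or generates points that converge to an  *)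
(* infeasible first-order critical point of theta.                            *)
Definition restoration_solver : Prop :=
  forall k y, result r = RestorationFails k y -> infeasible_critical_limit y.

(* For eps_theta = 0 the Criticality Routine is never run and nothing forces  *)
(* the radii to zero (e.g. unconstrained minimization of x ^+ 2 with exact    *)
(* models and constant radius), hence the guard on the last limit.            *)
Definition quasi_stationary_subsequence
    (X : nat -> V) (Chi Rad : nat -> R) : Prop :=
  exists (s : nat -> nat) (xbar : V),
    [/\ increasing_seq s,
        X \o s @ \oo --> xbar,
        theta (prob S) xbar = 0 /\ theta (prob S) \o X \o s @ \oo --> (0 : R),
        Chi \o s @ \oo --> (0 : R)
      & 0 < eps_theta c -> Rad \o s @ \oo --> (0 : R)].

Definition restoration_fails_at_critical_point : Prop :=
  exists k y, result r = RestorationFails k y /\ infeasible_critical_limit y.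

Definition converges_to_quasi_stationary : Prop :=
  match result r with
  | RunsForever => quasi_stationary_subsequence x chi (rad r)
  | EndlessRoutine k =>
      quasi_stationary_subsequence (fun=> x k) (chis r k) (rads r k)
  | RestorationFails _ _ => False
  end.

End Algorithm.
Arguments setting : clear implicits.
Arguments run : clear implicits.

(* Main.v *)
Require Import Defs.
From mathcomp Require Import all_boot all_order all_algebra.
From mathcomp Require Import all_classical all_reals all_analysis.
From mathcomp Require Import ring lra.
Set Implicit Arguments.
Unset Strict Implicit.
Unset Printing Implicit Defensive.
Import Order.TTheory GRing.Theory Num.Theory.
Import numFieldNormedType.Exports.
Local Open Scope classical_set_scope.
Local Open Scope ring_scope.
Local Notation rad := Defs.rad.

(* If the restoration fails, its assumed limit point is the claim. If the
   Criticality Routine is endless, its radii decrease geometrically and bound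
   both the criticality measures and, through the interpolating models, theta.
   In an infinite run, suppose that from some iteration on theta or chi is at
   least eps. A compatible step with chi >= eps and a small radius D decreases
   the model by at least a multiple of D, while theta, the trial value of theta
   and the model error are O(D^(1+mu)), O(D^2) and O(D^2), so the step passes
   the sufficient decrease, ratio and filter tests.
   - If infinitely many iterations change the filter, theta gets arbitrarily
     small on them (the iterates lie in a compact set and later ones are
     acceptable for earlier entries). One such iteration with tiny theta already
     gives a contradiction: if it is compatible, its radius is small and the
     decrease is sufficient; otherwise its radius is small and its predecessor
     would have been accepted, leaving theta = O(D^2), too small for an
     incompatible normal step.
   - Otherwise Phi eventually decreases, so the model decreases of accepted steps
     and theta tend to 0; then chi >= eps, the radii are bounded below, and so is
     the model decrease of accepted steps.
   Hence theta and chi tend to 0 along a subsequence; the criticality test and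
   the compatibility condition then force the radii to 0. *)

(** * Euclidean norm and first-order estimates *)

Section EuclideanNorm.
Context {R : realType} {n : nat}.
Local Notation V := 'rV[R]_n.
Implicit Types v w : V.

Definition inner v w : R := \sum_i v 0 i * w 0 i.

Lemma norm2_ge0 v : 0 <= norm2 v. Proof. exact: sqrtr_ge0. Qed.

Lemma sqr_norm2 v : norm2 v ^+ 2 = \sum_i v 0 i ^+ 2.
Proof. by rewrite sqr_sqrtr// sumr_ge0// => i _; exact: sqr_ge0. Qed.

Lemma norm2Z a v : norm2 (a *: v) = `|a| * norm2 v.
Proof.
rewrite /norm2; under eq_bigr do rewrite mxE exprMn.
by rewrite -mulr_sumr sqrtrM ?sqr_ge0// sqrtr_sqr.
Qed.

Lemma norm2_subC v w : norm2 (v - w) = norm2 (w - v).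
Proof. by rewrite -(opprB w v) -scaleN1r norm2Z normrN1 mul1r. Qed.

(** Lagrange's identity: the gap in the squared Cauchy-Schwarz inequality is half the double sum of
    the squared 2 by 2 minors of [v] and [w]. *)
Lemma inner_sqr_le v w : inner v w ^+ 2 <= norm2 v ^+ 2 * norm2 w ^+ 2.
Proof.
rewrite !sqr_norm2 -subr_ge0.
suff -> : (\sum_i v 0 i ^+ 2) * (\sum_i w 0 i ^+ 2) - inner v w ^+ 2 =
    2^-1 * \sum_i \sum_j (v 0 i * w 0 j - v 0 j * w 0 i) ^+ 2.
  by rewrite mulr_ge0 ?invr_ge0// !sumr_ge0// => i _; rewrite sumr_ge0// => j _;
     exact: sqr_ge0.
have sum_mul (a b : 'I_n -> R) :
    (\sum_i a i) * (\sum_i b i) = \sum_i \sum_j a i * b j.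
  by rewrite mulr_suml; apply: eq_bigr => i _; rewrite mulr_sumr.
rewrite expr2 /inner !sum_mul.
have -> : \sum_i \sum_j (v 0 i * w 0 j - v 0 j * w 0 i) ^+ 2 =
    \sum_i \sum_j v 0 i ^+ 2 * w 0 j ^+ 2 +
    \sum_i \sum_j v 0 j ^+ 2 * w 0 i ^+ 2 -
    2 * \sum_i \sum_j v 0 i * w 0 i * (v 0 j * w 0 j).
  rewrite mulr_sumr -big_split -sumrB /=; apply: eq_bigr => i _.
  rewrite mulr_sumr -big_split -sumrB /=; apply: eq_bigr => j _.
  by ring.
rewrite [X in _ = _ * (_ + X - _)]exchange_big /=.
by field.
Qed.

Lemma inner_le_norm2 v w : `|inner v w| <= norm2 v * norm2 w.
Proof.
rewrite -(@ler_pXn2r _ 2)// ?nnegrE ?mulr_ge0 ?norm2_ge0//.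
by rewrite real_normK ?num_real// exprMn inner_sqr_le.
Qed.

Lemma norm2D v w : norm2 (v + w) <= norm2 v + norm2 w.
Proof.
rewrite -(@ler_pXn2r _ 2)// ?nnegrE ?addr_ge0 ?norm2_ge0//.
have -> : norm2 (v + w) ^+ 2 = norm2 v ^+ 2 + 2 * inner v w + norm2 w ^+ 2.
  rewrite !sqr_norm2 /inner mulr_sumr -!big_split /=.
  by apply: eq_bigr => i _; rewrite mxE; ring.
have := le_trans (ler_norm _) (inner_le_norm2 v w).
by rewrite sqrrD -mulr_natl; lra.
Qed.

(** Links the maximum norm, in which boundedness is stated, to the Euclidean norm of the Lipschitz
    bounds. *)
Lemma norm2_le_mx_norm v : norm2 v <= n%:R * `|v|.
Proof.
rewrite -(@ler_pXn2r _ 2)// ?nnegrE ?mulr_ge0 ?norm2_ge0//.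
have coord i : `|v 0 i| <= `|v|.
  rewrite [leRHS]/Num.Def.normr /= mx_normrE.
  by apply: (@le_bigmax_cond _ _ _ _ (0, i) xpredT (fun j => `|v j.1 j.2|)).
rewrite sqr_norm2 exprMn (@le_trans _ _ (n%:R * `|v| ^+ 2))//.
  rewrite (@le_trans _ _ (\sum_(i < n) `|v| ^+ 2))//.
    apply: ler_sum => i _; rewrite -real_normK ?num_real//.
    by rewrite ler_pXn2r ?nnegrE.
  by rewrite sumr_const card_ord mulr_natl.
rewrite ler_wpM2r ?sqr_ge0//.
by rewrite -natrX ler_nat; case: (n) => // m; rewrite expnS expn1 leq_pmulr.
Qed.

End EuclideanNorm.

(** * Gradients, Jacobians and a first-order Taylor bound *)

Section Differentiation.
Context {R : realType} {n : nat}.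
Local Notation V := 'rV[R]_n.
Implicit Types (phi : V -> R) (x v : V).

Lemma derive_grad phi x v : differentiable phi x ->
  'D_v phi x = inner v (grad phi x).
Proof.
move=> dphi; rewrite deriveE// {1}(row_sum_delta v) linear_sum /=.
by apply: eq_bigr => i _; rewrite linearZ /= /grad mxE deriveE.
Qed.

Lemma differentiable_row {m} (F : V -> 'rV[R]_m) x :
  (forall l, differentiable (fun y => F y 0 l) x) -> differentiable F x.
Proof.
move=> dF; have -> : F = \sum_(l < m) (fun y => F y 0 l *: delta_mx 0 l).
  by apply/funext => y; rewrite fct_sumE -row_sum_delta.
apply: differentiable_sum => l.
exact: (@differentiable_comp _ _ _ _ (fun y => F y 0 l) ( *:%R ^~ _)).
Qed.

(** Translates the Jacobian products in [lin_set] into inner products with gradients of scalar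
    components, the objects that full linearity controls. *)
Lemma mulmx_jacobian {m} (F : V -> 'rV[R]_m) x v l :
  (forall l, differentiable (fun y => F y 0 l) x) ->
  (v *m 'J F x) 0 l = inner v (grad (fun y => F y 0 l) x).
Proof.
move=> dF; rewrite -deriveEjacobian; last exact: differentiable_row.
rewrite derive_mx; last exact/diff_derivable/differentiable_row.
by rewrite mxE derive_grad.
Qed.

Lemma mvt_segment phi x v :
  (forall t : R, 0 <= t <= 1 -> differentiable phi (x + t *: v)) ->
  exists2 t, 0 <= t <= 1 & phi (x + v) - phi x = inner v (grad phi (x + t *: v)).
Proof.
move=> dphi; pose f (t : R) := phi (x + t *: v).
have df (t : R) : 0 <= t <= 1 -> is_diff t f (fun h => 'd phi (x + t *: v) (h *: v)).
  move=> t01; have dx := differentiableP (dphi _ t01).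
  have dg : is_diff t (fun t : R => x + t *: v) (fun h : R => h *: v).
    by apply: is_diff_eq; rewrite add0r.
  exact: (@is_diff_comp _ _ _ _ _ _ phi ('d phi (x + t *: v)) _ dg dx).
have isd (t : R) : t \in `]0, 1[ ->
    is_derive t 1 f (inner v (grad phi (x + t *: v))).
  rewrite in_itv/= => /andP[/ltW t0 /ltW t1].
  have t01 : 0 <= t <= 1 by rewrite t0.
  have /= dft := df t t01; apply: DeriveDef.
    exact: diff_derivable.
  by rewrite deriveE// diff_val scale1r -derive_grad ?deriveE//; exact: dphi.
have cf : {within `[0, 1], continuous f}.
  apply: continuous_in_subspaceT => t; rewrite inE/= in_itv/= => t01.
  by have dft := df t t01; exact: differentiable_continuous.
have [t] := MVT_segment ler01 isd cf.
rewrite in_itv/= /f scale1r scale0r addr0 subr0 mulr1 => t01 ->.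
by exists t.
Qed.

(** By the mean value theorem the error is the inner product of [v] with a difference of gradients
    at two points of the segment; hence the constant [L] instead of [L / 2]. *)
Lemma taylor_lip (D : set V) (L : R) phi x v : 0 <= L -> lip_grad D L phi ->
  (forall t : R, 0 <= t <= 1 -> D (x + t *: v)) ->
  (forall y, D y -> differentiable phi y) ->
  `|phi (x + v) - phi x - inner v (grad phi x)| <= L * norm2 v ^+ 2.
Proof.
move=> L0 lip segD dphi.
have [t t01 ->] := mvt_segment (fun t t01 => dphi _ (segD t t01)).
have -> : inner v (grad phi (x + t *: v)) - inner v (grad phi x) =
    inner v (grad phi (x + t *: v) - grad phi x).
  by rewrite /inner -sumrB; apply: eq_bigr => i _; rewrite !mxE; ring.
have Dx : D x by have := segD 0; rewrite scale0r addr0; apply; rewrite lexx ler01.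
apply: le_trans (inner_le_norm2 _ _) _.
have := lip _ _ (segD t t01) Dx; rewrite (addrC x) addrK norm2Z.
case/andP: t01 => t0 t1; rewrite ger0_norm// => h.
rewrite expr2 mulrA [leRHS]mulrC ler_wpM2l ?norm2_ge0// (le_trans h)//.
by rewrite ler_wpM2l// ler_piMl ?norm2_ge0.
Qed.

End Differentiation.

(** * Subsequences and max-type functions *)

(** Supplies the thresholds below which a higher power of a radius or of theta is absorbed by a
    lower one. *)
Lemma powR_dominated {R : realType} (C p q : R) : q < p ->
  exists2 delta, 0 < delta & forall t, 0 < t <= delta -> C * t `^ p <= t `^ q.
Proof.
move=> qp; pose D := Num.max 1 C; have pq : 0 < p - q by rewrite subr_gt0.
have D0 : 0 < D by rewrite /D lt_max ltr01.
(* Solves D t^(p-q) = 1; the maximum with 1 keeps D positive for every sign of [C]. *)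
exists (D^-1 `^ (p - q)^-1); first by rewrite powR_gt0// invr_gt0.
move=> t /andP[t0 td]; have -> : p = q + (p - q) by rewrite addrC subrK.
rewrite powRD; last by rewrite (gt_eqF t0) implybT.
rewrite mulrCA ler_piMr ?powR_ge0//.
have : t `^ (p - q) <= D^-1.
  have -> : D^-1 = (D^-1 `^ (p - q)^-1) `^ (p - q).
    by rewrite -powRrM mulVf ?gt_eqF// powRr1// invr_ge0 ltW.
  by rewrite ge0_ler_powR ?nnegrE ?powR_ge0// ltW.
move=> tD; apply: (@le_trans _ _ (D * t `^ (p - q))).
  by rewrite ler_wpM2r ?powR_ge0// /D le_max lexx orbT.
by rewrite -ler_pdivlMl// mulr1.
Qed.

Section Subsequences.

(** Recursive choice: the index for l+1 is taken strictly beyond the one for l. *)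
Lemma increasing_choice (G : nat -> nat -> Prop) :
  (forall l N, exists2 k, (N <= k)%N & G l k) ->
  exists2 s : nat -> nat, increasing_seq s & forall l, G l (s l).
Proof.
move=> inf; pose g l N := projT1 (cid2 (inf l N)).
have gP l N : (N <= g l N)%N /\ G l (g l N).
  by rewrite /g; case: cid2.
pose s := fix s l := if l is l'.+1 then g l (s l').+1 else g 0%N 0%N.
exists s; last by case=> [|l] /=; [exact: (gP _ _).2|exact: (gP _ _).2].
by apply/increasing_seqP => l; exact: (gP _ _).1.
Qed.

Lemma increasing_seq_ge (s : nat -> nat) l : increasing_seq s -> (l <= s l)%N.
Proof.
move=> /increasing_seqP incr; elim: l => // l /leq_ltn_trans; apply.
exact: incr.
Qed.

Lemma increasing_seq_comp (s t : nat -> nat) :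
  increasing_seq s -> increasing_seq t -> increasing_seq (s \o t).
Proof. by move=> si ti k l; rewrite -[RHS]ti -[RHS]si. Qed.

(** Compactness yields a cluster point, whose balls of radius 1/(l+1) are met beyond every index;
    [increasing_choice] picks one index per ball. *)
Lemma compact_subsequence {R : realType} {V : normedModType R} (D : set V)
    (X : nat -> V) : compact D -> (forall k, D (X k)) ->
  exists (s : nat -> nat) (xbar : V), increasing_seq s /\ X \o s @ \oo --> xbar.
Proof.
move=> cD DX.
have [|xbar [_ clX]] := cD (X @ \oo) _.
  by exists 0%N => // k _; exact: DX.
pose G l k := `|xbar - X k| < l.+1%:R^-1.
have [l N|s si sG] := @increasing_choice G.
  have [] := clX (X @` [set k | (N <= k)%N]) (ball xbar l.+1%:R^-1).
  - by exists N => // k /= Nk; exists k.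
  - by apply: nbhsx_ballx; rewrite invr_gt0.
  move=> _ [[k /= Nk <-]]; rewrite -ball_normE /= => bk.
  by exists k.
exists s, xbar; split => //; apply/cvgrPdist_lt => e e0.
near=> l; apply: lt_trans (sG l) _; near: l.
exact: near_infty_natSinv_lt (PosNum e0).
Unshelve. all: by end_near. Qed.

End Subsequences.

(** * Bounds and continuity for Phi and theta *)

Section Aggregates.
Context {R : realType} {n K M P : nat}.
Local Notation V := 'rV[R]_n.
Implicit Types (p q : mop R n K M P) (x y : V).

Lemma Phi_ge p x l : obj p x 0 l <= Phi p x.
Proof. exact: le_bigmax. Qed.

Lemma Phi_le p x b : (forall l, obj p x 0 l <= b) -> Phi p x <= b.
Proof. by move=> ob; apply: bigmax_le. Qed.

Lemma theta_ge0 p x : 0 <= theta p x.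
Proof. by rewrite /theta le_max; apply/orP; left; exact: bigmax_ge_id. Qed.

Lemma theta_ge_eqc p x l : `|eqc p x 0 l| <= theta p x.
Proof.
rewrite /theta le_max; apply/orP; left.
exact: (le_bigmax _ (fun l => `|eqc p x 0 l|)).
Qed.

Lemma theta_ge_ineq p x l : ineq p x 0 l <= theta p x.
Proof.
rewrite /theta le_max; apply/orP; right.
exact: (le_bigmax _ (fun l => ineq p x 0 l)).
Qed.

Lemma theta_le p x b : 0 <= b -> (forall l, `|eqc p x 0 l| <= b) ->
  (forall l, ineq p x 0 l <= b) -> theta p x <= b.
Proof. by move=> b0 eb ib; rewrite /theta ge_max !bigmax_le. Qed.

(** A maximum is nonexpansive in its entries. Both problem and point may differ, so the bound
    compares a function with its model as well as one model at two points. *)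
Lemma Phi_dist p q x y e :
  (forall l, `|obj p x 0 l - obj q y 0 l| <= e) -> `|Phi p x - Phi q y| <= e.
Proof.
move=> pq; rewrite ler_distl; apply/andP; split.
  rewrite lerBlDr; apply: Phi_le => l; rewrite -lerBlDr.
  by apply: le_trans (Phi_ge p x l); have := pq l; rewrite ler_distl => /andP[].
apply: Phi_le => l; have := pq l; rewrite ler_distl => /andP[_ /le_trans]; apply.
by rewrite lerD2r Phi_ge.
Qed.

Lemma theta_dist p x y e :
  (forall i, `|component p i x - component p i y| <= e) ->
  0 <= e -> `|theta p x - theta p y| <= e.
Proof.
have le a b : (forall i, `|component p i a - component p i b| <= e) ->
    0 <= e -> theta p a <= theta p b + e.
  move=> pq e0; apply: theta_le => [|l|l]; first by rewrite addr_ge0// theta_ge0.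
    have /= := pq (inl (inr l)); have := theta_ge_eqc p b l.
    have := ler_normD (eqc p b 0 l) (eqc p a 0 l - eqc p b 0 l).
    rewrite addrC subrK.
    by lra.
  have /= := pq (inr l); rewrite ler_distl => /andP[_].
  by have := theta_ge_ineq p b l; lra.
move=> pq e0.
have qp i : `|component p i y - component p i x| <= e by rewrite distrC.
by rewrite ler_distl lerBlDr (le x y pq e0) (le y x qp e0).
Qed.

Lemma cvg_components p (X : nat -> V) xbar (e : R) :
  (forall i, {for xbar, continuous (component p i)}) ->
  X @ \oo --> xbar -> 0 < e ->
  \forall k \near \oo, forall i, `|component p i xbar - component p i (X k)| <= e.
Proof.
move=> cp Xx e0.
have ncomp i : \forall k \near \oo,
    `|component p i xbar - component p i (X k)| <= e.
  have : component p i \o X @ \oo --> component p i xbar.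
    exact: cvg_comp Xx (cp i).
  by move=> /cvgrPdist_le; apply.
have nobj : \forall k \near \oo, forall l,
    `|component p (inl (inl l)) xbar - component p (inl (inl l)) (X k)| <= e.
  by apply: filter_forall => l; exact: ncomp.
have neqc : \forall k \near \oo, forall l,
    `|component p (inl (inr l)) xbar - component p (inl (inr l)) (X k)| <= e.
  by apply: filter_forall => l; exact: ncomp.
have nineq : \forall k \near \oo, forall l,
    `|component p (inr l) xbar - component p (inr l) (X k)| <= e.
  by apply: filter_forall => l; exact: ncomp.
by apply: filterS3 nobj neqc nineq => k co ce ci [[l|l]|l].
Qed.

Lemma cvg_theta p (X : nat -> V) xbar :
  (forall i, {for xbar, continuous (component p i)}) ->
  X @ \oo --> xbar -> theta p \o X @ \oo --> theta p xbar.
Proof.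
move=> cp Xx; apply/cvgrPdist_le => e e0.
near=> k; apply: theta_dist; last exact: ltW.
by near: k; exact: cvg_components.
Unshelve. all: by end_near. Qed.

Lemma cvg_Phi p (X : nat -> V) xbar :
  (forall i, {for xbar, continuous (component p i)}) ->
  X @ \oo --> xbar -> Phi p \o X @ \oo --> Phi p xbar.
Proof.
move=> cp Xx; apply/cvgrPdist_le => e e0.
near=> k; have close : forall i : comp_index K M P,
    `|component p i xbar - component p i (X k)| <= e.
  by near: k; exact: cvg_components.
by apply: Phi_dist => l; exact: (close (inl (inl l))).
Unshelve. all: by end_near. Qed.

End Aggregates.

(** * Convergence from uniform step estimates *)

Section Filter.
Context {R : realType} {n K M P : nat}.
Local Notation V := 'rV[R]_n.
Variable (S : setting R n K M P).
Implicit Types (y z : V) (F : seq (R * R)).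

Lemma acceptable_filter_add y z F :
  acceptable S y ((theta (prob S) z, Phi (prob S) z) :: F) ->
  acceptable S y (filter_add S z F).
Proof.
move=> /= /andP[yz yF]; rewrite /filter_add /= yz /=.
by apply/allP => p; rewrite mem_filter => /andP[_]; move/allP: yF; apply.
Qed.

(* A discarded entry imposes a weaker condition than the entry replacing it. *)
Lemma acceptable_filter_addW y z F : 0 < gamma_theta (par S) < 1 ->
  acceptable S y (filter_add S z F) ->
  acceptable S y ((theta (prob S) z, Phi (prob S) z) :: F).
Proof.
move=> /andP[g0 g1] /= /andP[yz /allP yF]; rewrite yz /=; apply/allP => p pF.
have [dom|ndom] := boolP ((theta (prob S) z <= p.1) &&
    (Phi (prob S) z - gamma_theta (par S) * theta (prob S) z
      <= p.2 - gamma_theta (par S) * p.1)); last by apply: yF; rewrite mem_filter ndom.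
case/andP: dom => dom1 dom2; case/orP: yz => yz; apply/orP; [left|right].
  by apply: le_trans yz _; rewrite ler_wpM2l// subr_ge0 ltW.
exact: le_trans dom2.
Qed.

Lemma acceptable_mono y z F : theta (prob S) z <= theta (prob S) y ->
  Phi (prob S) z <= Phi (prob S) y -> acceptable S y F -> acceptable S z F.
Proof.
move=> zt zp /allP yF; apply/allP => p /yF /orP[/(le_trans zt)->//|/(le_trans zp)->].
by rewrite orbT.
Qed.

End Filter.

(** * Infinite runs, seen only through estimates with two constants [a] and [C] *)

Section InfiniteRun.
Context {R : realType} {n K M P : nat}.
Local Notation V := 'rV[R]_n.
Variables (S : setting R n K M P) (r : run R n K M P).
Variables (delta_n a C : R) (D : set V).
Local Notation c := (par S).
Local Notation x := (pt r).
Local Notation compat k := (has_compatible S r k 0).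
(** The exponent from the compatibility condition: compatible normal steps for radius D have length
    O(D^e). *)
Let e := 1 + mu c.

Hypothesis params_ok : valid_params c delta_n.
Hypothesis iterations : forall k, iteration S r k.
Hypothesis filter0 : filter_at r 0 = [::].
Hypothesis compD : compact D.
Hypothesis ptD : forall k, D (x k).
Hypothesis cont : forall i y, {for y, continuous (component (prob S) i)}.
Hypothesis delta_n_gt0 : 0 < delta_n.
Hypothesis a_gt0 : 0 < a.
Hypothesis C_gt0 : 0 < C.
Hypothesis rad_bounds : forall k, 0 < rad r k <= rads r k 0.
Hypothesis theta_le_rad : forall k, compat k ->
  theta_at S r k <= C * rad r k `^ e.
Hypothesis theta_xs_le : forall k, compat k ->
  theta (prob S) (xs r k) <= C * rad r k ^+ 2.
(** The product is the decrease along the tangential step; the subtracted term bounds the change of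
    the model along the normal step, here through its compatibility and in [decrease_theta] through
    theta. *)
Hypothesis decrease_rad : forall k, compat k ->
  a * chi r k * Num.min (a * chi r k) (Num.min (rad r k) 1)
    - C * rad r k `^ e <= model_decrease r k.
Hypothesis decrease_theta : forall k, compat k -> theta_at S r k <= delta_n ->
  a * chi r k * Num.min (a * chi r k) (Num.min (rad r k) 1)
    - C * theta_at S r k <= model_decrease r k.
Hypothesis Phi_xs_dist : forall k, compat k ->
  `|Phi (prob S) (xs r k) - Phi_at S r k + model_decrease r k|
    <= C * rad r k ^+ 2.
(** A normal step of length O(theta) can be incompatible only if the radius is small relative to
    theta. *)
Hypothesis incompatible_radius : forall k, ~ compat k ->
  theta_at S r k <= delta_n -> rads r k 0 `^ e <= C * theta_at S r k.
Hypothesis rad_ge_chi : forall k, compat k ->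
  Num.min (rads r k 0) (cB c * chi r k) <= rad r k.
Hypothesis chi_ge0 : forall k, compat k \/ theta_at S r k <= delta_n ->
  0 <= chi r k.
Hypothesis final_radius_small : forall k, compat k ->
  theta_at S r k < eps_theta c -> chi r k < eps_chi c ->
  rad r k <= cM c * chi r k \/ rad r k `^ e <= C * theta_at S r k.

Let mu01 : 0 < mu c < 1.
Proof. by have [_ _ _ _ [_ [_ _ _ _ [_ ?]]]] := params_ok. Qed.
Let gamma01 : 0 < gamma_theta c < 1.
Proof. by have [_ _ _ _ [_ [_ _ ? _ _]]] := params_ok. Qed.
Let e_gt1 : 1 < e. Proof. by rewrite /e ltrDl; case/andP: mu01. Qed.
Let e_gt0 : 0 < e. Proof. exact: lt_trans e_gt1. Qed.
Let e_lt2 : e < 2. Proof. by rewrite /e; case/andP: mu01; lra. Qed.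
(** This is where psi > 1/(1+mu) enters: theta = O(D^e) makes theta^psi of smaller order than the
    radius D. *)
Let psi_e_gt1 : 1 < e * psi c.
Proof.
have [_ _ _ _ [[_ +] _]] := params_ok.
by rewrite -ltr_pdivrMl// mulr1.
Qed.
Let psi_gt0 : 0 < psi c.
Proof. by rewrite -(pmulr_rgt0 _ e_gt0) (lt_trans _ psi_e_gt1). Qed.
Let kappa_gt0 : 0 < kappa_theta c.
Proof. by have [_ _ _ _ [[/andP[]]]] := params_ok. Qed.
Let theta0 k : 0 <= theta_at S r k. Proof. exact: theta_ge0. Qed.
Let rad_gt0 k : 0 < rad r k. Proof. by case/andP: (rad_bounds k). Qed.
Let rads_gt0 k : 0 < rads r k 0.
Proof. by case/andP: (rad_bounds k) => /lt_le_trans; apply. Qed.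

(** For small radii the model decrease is at least [b] times the radius, while theta^psi, the model
    error and theta are of higher order. *)
Lemma small_radius_step (eps : R) : 0 < eps -> exists2 tau, 0 < tau &
  forall k, compat k -> eps <= chi r k -> rad r k <= tau ->
  [/\ sufficient_decrease S r k, nu0 c <= rho S r k
    & Phi (prob S) (xs r k) <= Phi_at S r k - gamma_theta c * theta_at S r k].
Proof.
(* The tangential decrease is at least [2 * b] times the radius; one half is given up for the loss
   along the normal step. *)
move=> eps0; pose b := a * eps / 2.
have ae0 : 0 < a * eps by rewrite mulr_gt0.
have b0 : 0 < b by rewrite divr_gt0.
have lt12 : 1 < 2 :> R by rewrite ltr1n.
have [_ _ [nu1_gt0 nu10 nu0_lt1] _ _] := params_ok.
have nu0_gt0 : 0 < nu0 c := lt_le_trans nu1_gt0 nu10.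
have [t1 t1_gt0 small1] := powR_dominated (C / b) e_gt1.
have [t2 t2_gt0 small2] := powR_dominated (kappa_theta c * C `^ psi c / b) psi_e_gt1.
have [t3 t3_gt0 small3] :=
  powR_dominated (C / ((1 - nu0 c) * b)) lt12.
have [t4 t4_gt0 small4] := powR_dominated (gamma_theta c * C / (nu0 c * b)) e_gt1.
(* [t1] absorbs the normal step, [t2] gives sufficient decrease, [t3] the ratio test and [t4] the
   drop of Phi. The last two entries make the radius bound the inner minimum of [decrease_rad] from
   below. *)
pose tau := Num.min (Num.min (Num.min t1 t2) (Num.min t3 t4)) (Num.min (a * eps) 1).
exists tau; first by rewrite !lt_min ae0 ltr01 t1_gt0 t2_gt0 t3_gt0 t4_gt0.
move=> k ck chik; rewrite !le_min => /andP[/andP[/andP[r1 r2] /andP[r3 r4]] /andP[r5 r6]].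
have r0 := rad_gt0 k.
have {small1 r1} s1 : C * rad r k `^ e <= b * rad r k.
  have := small1 (rad r k); rewrite r0 r1 powRr1 ?(ltW r0)// => /(_ isT).
  by rewrite mulrAC ler_pdivrMr// (mulrC b).
have {small2 r2} s2 : kappa_theta c * C `^ psi c * rad r k `^ (e * psi c) <= b * rad r k.
  have := small2 (rad r k); rewrite r0 r2 powRr1 ?(ltW r0)// => /(_ isT).
  by rewrite mulrAC ler_pdivrMr// (mulrC b).
have {small3 r3} s3 : C * rad r k ^+ 2 <= (1 - nu0 c) * (b * rad r k).
  have := small3 (rad r k); rewrite r0 r3 powRr1 ?(ltW r0)// powR_mulrn ?(ltW r0)//.
  move=> /(_ isT); rewrite mulrAC ler_pdivrMr ?mulr_gt0 ?subr_gt0//.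
  by move=> /le_trans; apply; rewrite mulrC -mulrA.
have {small4 r4} s4 : gamma_theta c * C * rad r k `^ e <= nu0 c * (b * rad r k).
  have := small4 (rad r k); rewrite r0 r4 powRr1 ?(ltW r0)// => /(_ isT).
  rewrite mulrAC ler_pdivrMr ?mulr_gt0//.
  by move=> /le_trans; apply; rewrite mulrC -mulrA.
have mdb : b * rad r k <= model_decrease r k.
  apply: le_trans (decrease_rad ck).
  have : a * eps * rad r k <=
      a * chi r k * Num.min (a * chi r k) (Num.min (rad r k) 1).
    have ac : a * eps <= a * chi r k by rewrite ler_wpM2l// ltW.
    rewrite ler_pM ?(ltW ae0) ?(ltW r0)// !le_min lexx r6 andbT.
    by rewrite (le_trans r5).
  have -> : a * eps * rad r k = b * rad r k + b * rad r k by rewrite /b; field.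
  by move: s1; lra.
have md0 : 0 < model_decrease r k by apply: lt_le_trans mdb; rewrite mulr_gt0.
have Phi_drop : nu0 c * model_decrease r k <= Phi_at S r k - Phi (prob S) (xs r k).
  have := Phi_xs_dist ck; rewrite ler_norml => /andP[_ h].
  have : (1 - nu0 c) * (b * rad r k) <= (1 - nu0 c) * model_decrease r k.
    by rewrite ler_wpM2l// subr_ge0 ltW.
  by move: s3 h; rewrite [(1 - _) * model_decrease _ _]mulrBl; lra.
split.
- rewrite /sufficient_decrease; apply: le_trans mdb; apply: le_trans s2.
  rewrite -mulrA ler_wpM2l ?(ltW kappa_gt0)// powRrM.
  rewrite -powRM ?(ltW C_gt0) ?powR_ge0// ge0_ler_powR ?(ltW psi_gt0) ?nnegrE//.
    by rewrite mulr_ge0 ?powR_ge0 ?(ltW C_gt0).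
  exact: theta_le_rad.
- by rewrite /rho ler_pdivlMr.
- rewrite lerBrDl -lerBrDr; apply: le_trans Phi_drop.
  apply: (@le_trans _ _ (nu0 c * (b * rad r k))); last by rewrite ler_wpM2l// ltW.
  apply: le_trans s4; rewrite -mulrA ler_wpM2l ?theta_le_rad//.
  by case/andP: gamma01 => /ltW.
Qed.

(** Incompatible iterations satisfy the implication vacuously, as they should: restoration also adds
    the current point to the filter. *)
Definition filter_iteration k : Prop :=
  compat k -> ~~ rejected S r k /\ ~~ sufficient_decrease S r k.

Lemma filter_step k : filter_iteration k ->
  filter_at r k.+1 = filter_add S (x k) (filter_at r k).
Proof.
have [itc iti] := iterations k; move=> Zk.
have [ck|/iti[_ _ _ -> _]//] := pselect (compat k).
have [_ _] := itc ck; rewrite /acceptance_step.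
by have [/negPf -> /negPf ->] := Zk ck; case.
Qed.

Lemma no_filter_step k : ~ filter_iteration k ->
  compat k /\ filter_at r k.+1 = filter_at r k.
Proof.
have [itc iti] := iterations k; move=> nZ.
have [ck|nc] := pselect (compat k); last by case: nZ.
split=> //; have [_ _] := itc ck; rewrite /acceptance_step.
case: ifPn => [_ [_ -> _]//|nrej [_ -> _]].
by case: ifPn => // nsuff; case: nZ.
Qed.

(** A rejection changes neither point nor filter, an accepted trial point was tested against the
    filter together with the current pair, and restoration returns acceptable points. *)
Lemma pt_acceptable k : acceptable S (x k) (filter_at r k).
Proof.
elim: k => [|k IH]; first by rewrite filter0.
have [itc iti] := iterations k.
have [ck|/iti[_ _ _ _ [_ _ //]]] := pselect (compat k).
have [_ _] := itc ck; rewrite /acceptance_step.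
case: ifPn => [_ [-> -> _]//|]; rewrite /rejected negb_or negbK => /andP[acc _].
move=> [-> -> _]; case: ifP => _; last exact: acceptable_filter_add.
by move: acc => /= /andP[].
Qed.

(** Discarding entries loses nothing, since each discarded condition follows from the one of the
    added entry. *)
Lemma acceptable_antitone y j k : (j <= k)%N ->
  acceptable S y (filter_at r k) -> acceptable S y (filter_at r j).
Proof.
move=> /subnKC <-; elim: (k - j)%N => [|l IH]; first by rewrite addn0.
rewrite addnS => acc; apply: IH; move: acc.
have [Z|/no_filter_step[_ ->]//] := pselect (filter_iteration (j + l)).
by rewrite filter_step// => /(acceptable_filter_addW gamma01) /= /andP[].
Qed.

Lemma filter_iteration_separates j k : filter_iteration j -> (j < k)%N ->
  theta_at S r k <= (1 - gamma_theta c) * theta_at S r j \/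
  Phi_at S r k <= Phi_at S r j - gamma_theta c * theta_at S r j.
Proof.
move=> Zj jk; have := acceptable_antitone jk (pt_acceptable k).
rewrite filter_step// => /(acceptable_filter_addW gamma01) /= /andP[].
by move=> /orP.
Qed.

(** Otherwise filter iterations with theta at least [tau] have a convergent subsequence, along which
    theta and Phi converge; yet from each member to the next, theta or Phi must drop by
    [gamma_theta * tau]. *)
Lemma theta_small_filter_iteration (tau : R) :
  (forall N, exists2 k, (N <= k)%N & filter_iteration k) -> 0 < tau ->
  forall N, exists k, [/\ (N <= k)%N, filter_iteration k & theta_at S r k < tau].
Proof.
move=> inf tau0 N; apply: contrapT => none.
have big k : (N <= k)%N -> filter_iteration k -> tau <= theta_at S r k.
  by move=> Nk Zk; rewrite leNgt; apply/negP => lt; apply: none; exists k.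
have [_ L|s si sZ] := @increasing_choice
    (fun _ k => (N <= k)%N /\ filter_iteration k).
  have [k Lk Zk] := inf (maxn N L); move: Lk; rewrite geq_max => /andP[Nk Lk].
  by exists k.
have [t [xbar [ti cvg_x]]] := compact_subsequence compD (fun l => ptD (s l)).
have incr l : (s (t l) < s (t l.+1))%N.
  have := increasing_seq_comp si ti; move/increasing_seqP => /(_ l).
  by [].
have cth := cvg_theta (fun i => @cont i xbar) cvg_x.
have cph := cvg_Phi (fun i => @cont i xbar) cvg_x.
have /andP[g0 _] := gamma01.
(* Two values within [d] of a common limit differ by less than the forced drop. *)
pose d := gamma_theta c * tau / 2.
have d0 : 0 < d by rewrite divr_gt0// mulr_gt0.
have /cvgrPdist_lt/(_ d d0) nth := cth; have /cvgrPdist_lt/(_ d d0) nph := cph.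
have [L _ close] : \forall l \near \oo,
    `|theta (prob S) xbar - theta_at S r (s (t l))| < d /\
    `|Phi (prob S) xbar - Phi_at S r (s (t l))| < d.
  near=> l; split; [near: l; exact: nth|near: l; exact: nph].
have [tL pL] := close L (leqnn L); have [tL1 pL1] := close L.+1 (leqnSn L).
have [NL ZL] := sZ (t L); have := big _ NL ZL => bigL.
have gt : gamma_theta c * tau <= gamma_theta c * theta_at S r (s (t L)).
  by rewrite ler_wpM2l// ltW.
move: tL pL tL1 pL1; rewrite !ltr_norml /d => /andP[? ?] /andP[? ?] /andP[? ?] /andP[? ?].
by case: (filter_iteration_separates ZL (incr L)); rewrite ?mulrBl; lra.
Unshelve. all: by end_near. Qed.

Lemma radius_step k : compat k -> gamma0 c * rad r k <= rads r k.+1 0.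
Proof.
move=> ck; have [/(_ ck)[_ _ +] _] := iterations k.
have [_ [g0 g01 g1 g2] _ _ _] := params_ok.
have le1 : gamma0 c * rad r k <= rad r k.
  by rewrite ler_piMl ?(ltW (rad_gt0 k))// (le_trans g01)// ltW.
rewrite /acceptance_step; case: ifP => _ [_ _]; first by case/andP.
by case: ifP => _ /andP[] // + _; exact: le_trans.
Qed.

Lemma acceptable_pair k F : acceptable S (xs r k) F ->
  Phi (prob S) (xs r k) <= Phi_at S r k - gamma_theta c * theta_at S r k ->
  acceptable S (xs r k) ((theta_at S r k, Phi_at S r k) :: F).
Proof. by move=> acc le; rewrite /= le orbT. Qed.

Lemma rejectedP k : rejected S r k -> sufficient_decrease S r k ->
  nu0 c <= rho S r k ->
  ~~ acceptable S (xs r k) ((theta_at S r k, Phi_at S r k) :: filter_at r k).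
Proof.
move=> /orP[//|/andP[_ low]] _ high; move: low.
have [_ _ [_ nu10 _] _ _] := params_ok.
by rewrite ltNge (le_trans nu10 high).
Qed.

(** * Refuting a uniform lower bound on theta or chi *)

Section NotQuasiStationary.
Variables (eps : R) (k0 : nat).
Hypothesis eps_gt0 : 0 < eps.
Hypothesis separated : forall k, (k0 <= k)%N ->
  eps <= theta_at S r k \/ eps <= chi r k.

Lemma chi_ge_eps k : (k0 <= k)%N -> theta_at S r k < eps -> eps <= chi r k.
Proof. by move=> /separated[|//]; rewrite leNgt => /negP. Qed.

Lemma decrease_bound (d : R) : 0 < d -> exists2 z, 0 < z &
  forall k, compat k -> theta_at S r k <= delta_n -> eps <= chi r k ->
  d <= rad r k -> z - C * theta_at S r k <= model_decrease r k.
Proof.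
move=> d0; have ae : 0 < a * eps by rewrite mulr_gt0.
exists (a * eps * Num.min (a * eps) (Num.min d 1)).
  by rewrite mulr_gt0// !lt_min ae d0 ltr01.
move=> k ck tk chik dk; apply: le_trans (decrease_theta ck tk).
have ac : a * eps <= a * chi r k by rewrite ler_wpM2l// ltW.
rewrite lerD2r ler_pM ?(ltW ae)//; first by rewrite !le_min (ltW ae) (ltW d0) ler01.
by rewrite !le_min !ge_min ac dk lexx /= !orbT.
Qed.

Lemma infinitely_many_filter_iterations_false :
  (forall N, exists2 k, (N <= k)%N & filter_iteration k) -> False.
Proof.
move=> inf; have [tau tau0 small_step] := small_radius_step eps_gt0.
have [z z0 dec] := decrease_bound tau0.
have [_ [g0 _ _ _] _ _ _] := params_ok.
(* The radius of the preceding iteration is at most the present one divided by [gamma0 c]. The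
   factor is chosen so that its trial point then has at most half of the present theta. *)
have [t2 t20 dom] := @powR_dominated R (2 * C ^+ 2 / gamma0 c ^+ 2) 2 e e_lt2.
pose u := Num.min t2 (gamma0 c * tau).
have u0 : 0 < u by rewrite lt_min t20 mulr_gt0.
have [t3 t30 psi_small] := @powR_dominated R (2 * kappa_theta c / z) (psi c) 0 psi_gt0.
have ue0 : 0 < u `^ e by exact: powR_gt0.
(* Theta below [eps] forces chi to be large, and below [delta_n] it bounds normal steps. The entries
   [t3] and [z / (2 * C)] exclude an insufficient decrease at a large radius; the last one pushes
   the radius of an incompatible iteration below [u]. *)
pose eta := Num.min (Num.min eps delta_n)
  (Num.min (Num.min t3 (z / (2 * C))) (u `^ e / C)).
have eta0 : 0 < eta.
  by rewrite !lt_min eps_gt0 delta_n_gt0 t30 !divr_gt0// mulr_gt0.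
(* Searching beyond [k0] leaves a predecessor to which [separated] still applies. *)
have [k [k0k Zk]] := theta_small_filter_iteration inf eta0 k0.+1.
rewrite !lt_min -!andbA => /and5P[te td tt tz tu].
have [ck|nck] := pselect (compat k).
  have chik := chi_ge_eps (ltnW k0k) te.
  have [_ nsuff] := Zk ck.
  have [small|big] := leP (rad r k) tau.
    by have [suff _ _] := small_step k ck chik small; rewrite suff in nsuff.
  have := dec k ck (ltW td) chik (ltW big).
  move: nsuff; rewrite /sufficient_decrease -ltNge => lt.
  have : C * theta_at S r k < z / 2.
    by move: tz; rewrite invfM mulrA ltr_pdivlMr// mulrC.
  have : kappa_theta c * theta_at S r k `^ psi c <= z / 2.
    have [->|tn0] := eqVneq (theta_at S r k) 0.
      by rewrite powR0 ?gt_eqF// mulr0 divr_ge0// ltW.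
    have := psi_small (theta_at S r k); rewrite lt_neqAle eq_sym tn0 theta0 (ltW tt).
    rewrite powRr0 => /(_ isT); rewrite mulrAC ler_pdivrMr// mul1r -mulrA.
    by rewrite ler_pdivlMr// mulrC.
  by lra.
case: k => [//|k] in k0k Zk te td tt tz tu nck *.
(* Restoration would have returned a point with a compatible normal step, so the predecessor is
   compatible. *)
have ck : compat k.
  apply: contrapT => nc; have [_ /(_ nc)[_ _ _ _ [_ cS _]]] := iterations k.
  exact: nck.
have small_rads : rads r k.+1 0 `^ e <= C * theta_at S r k.+1 :=
  incompatible_radius nck (ltW td).
have rads_u : rads r k.+1 0 < u.
  rewrite ltNge; apply/negP => le.
  have : u `^ e <= rads r k.+1 0 `^ e.
    by rewrite ge0_ler_powR ?nnegrE ?(ltW e_gt0)// ltW.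
  move=> /le_trans/(_ small_rads); apply/negP; rewrite -ltNge.
  by rewrite mulrC -ltr_pdivlMr.
move: (rads_u); rewrite lt_min => /andP[rads_t2 rads_tau].
have rads_e0 : 0 < rads r k.+1 0 `^ e by exact: powR_gt0.
have rad_rads : rad r k <= rads r k.+1 0 / gamma0 c.
  by rewrite ler_pdivlMr// mulrC radius_step.
have xs_small : 2 * theta (prob S) (xs r k) <= theta_at S r k.+1.
  rewrite -(ler_pM2l C_gt0); apply: le_trans small_rads.
  have := dom (rads r k.+1 0); rewrite rads_gt0 (ltW rads_t2) => /(_ isT).
  apply: le_trans; rewrite powR_mulrn ?(ltW (rads_gt0 _))//.
  have -> : 2 * C ^+ 2 / gamma0 c ^+ 2 * rads r k.+1 0 ^+ 2 =
      C * (2 * (C * (rads r k.+1 0 / gamma0 c) ^+ 2)).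
    by field; rewrite gt_eqF.
  rewrite ler_pM2l// ler_pM2l//; apply: le_trans (theta_xs_le ck) _.
  rewrite ler_pM2l// ler_pXn2r ?nnegrE ?(ltW (rad_gt0 k))//.
  by rewrite divr_ge0// ltW.
have th0 : 0 < theta_at S r k.+1.
  by rewrite -(pmulr_rgt0 _ C_gt0); exact: lt_le_trans small_rads.
(* An accepted trial point would be the present point, with at most half of its own positive theta.
   A rejected one leaves the point unchanged and improves on it in theta and Phi, so the filter
   cannot have refused it. *)
have [/(_ ck)[_ _ +] _] := iterations k; rewrite /acceptance_step.
case: ifPn => [rej [xS _ _]|_ [xS _ _]]; last first.
  by move: xs_small th0; rewrite /theta_at xS; lra.
have thS : theta_at S r k.+1 = theta_at S r k by rewrite /theta_at xS.
have chik : eps <= chi r k by apply: chi_ge_eps => //; rewrite -thS.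
have [|suff rho0 drop] := small_step k ck chik.
  by rewrite (le_trans rad_rads)// ler_pdivrMr// mulrC ltW.
have /negP := rejectedP rej suff rho0; apply.
apply: acceptable_pair => //; apply: acceptable_mono (pt_acceptable k).
  have := theta_ge0 (prob S) (xs r k); move: xs_small; rewrite thS /theta_at; lra.
apply: le_trans drop _; rewrite lerBlDr lerDl mulr_ge0//.
by case/andP: gamma01 => /ltW.
Qed.

(** * Runs whose filter is eventually constant *)

Section FinitelyManyFilterIterations.
Variable k1 : nat.
Hypothesis no_filter : forall k, (k1 <= k)%N -> ~ filter_iteration k.

Lemma late_compatible k : (k1 <= k)%N -> compat k.
Proof. by move=> /no_filter /no_filter_step[]. Qed.

Lemma late_filter k : (k1 <= k)%N -> filter_at r k = filter_at r k1.
Proof.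
move=> /subnKC <-; elim: (k - k1)%N => [|l IH]; first by rewrite addn0.
by rewrite addnS (no_filter_step (no_filter (leq_addr _ _))).2.
Qed.

Lemma late_rejected k : (k1 <= k)%N -> rejected S r k ->
  x k.+1 = x k /\ rads r k.+1 0 <= gamma1 c * rads r k 0.
Proof.
move=> k1k rej; have [/(_ (late_compatible k1k))[_ _ +] _] := iterations k.
rewrite /acceptance_step rej => -[-> _ /andP[_ le]]; split => //.
apply: le_trans le _; have [_ [g0 g01 _ _] _ _ _] := params_ok.
rewrite ler_wpM2l ?(le_trans (ltW g0))//.
by case/andP: (rad_bounds k).
Qed.

Lemma late_accepted k : (k1 <= k)%N -> ~~ rejected S r k ->
  [/\ 0 < model_decrease r k, sufficient_decrease S r k
    & nu1 c * model_decrease r k <= Phi_at S r k - Phi_at S r k.+1].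
Proof.
move=> k1k nrej; have dec : sufficient_decrease S r k.
  by apply/negPn/negP => nsuff; apply: (no_filter k1k) => _; split.
have [/(_ (late_compatible k1k))[_ _ +] _] := iterations k.
rewrite /acceptance_step (negPf nrej) => -[xS _ _].
rewrite [Phi_at S r k.+1]/Phi_at xS.
move: nrej; rewrite /rejected negb_or dec /= -leNgt => /andP[_].
have [_ _ [nu1_gt0 _ _] _ _] := params_ok.
have md_ge0 : 0 <= model_decrease r k.
  by apply: le_trans dec; rewrite mulr_ge0 ?powR_ge0// ltW.
(* Division by zero yields 0, so a vanishing model decrease would give ratio 0, below [nu1 c]. *)
have [md0|mdn0] := eqVneq (model_decrease r k) 0.
  by rewrite /rho md0 invr0 mulr0 leNgt nu1_gt0.
have md_gt0 : 0 < model_decrease r k by rewrite lt_neqAle eq_sym mdn0.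
by rewrite /rho ler_pdivlMr.
Qed.

Lemma late_Phi_noninc j k : (k1 <= j)%N -> (j <= k)%N ->
  Phi_at S r k <= Phi_at S r j.
Proof.
move=> k1j /subnKC <-; elim: (k - j)%N => [|l IH]; first by rewrite addn0.
apply: le_trans IH; rewrite addnS.
have k1k : (k1 <= j + l)%N := leq_trans k1j (leq_addr _ _).
have [rej|nrej] := boolP (rejected S r (j + l)).
  by rewrite /Phi_at (late_rejected k1k rej).1.
have [md0 _ le] := late_accepted k1k nrej.
rewrite -subr_ge0; apply: le_trans le; rewrite mulr_ge0 ?(ltW md0)//.
by have [_ _ [/ltW]] := params_ok.
Qed.

(** Phi no longer increases and converges along a subsequence. The drop over one accepted step is at
    most the drop between two late members of that subsequence, and at least [nu1] times the model
    decrease. *)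
Lemma late_decrease_small (tau : R) : 0 < tau -> exists2 N, (k1 <= N)%N &
  forall k, (N <= k)%N -> ~~ rejected S r k -> model_decrease r k < tau.
Proof.
move=> tau0; have [_ _ [nu1_gt0 _ _] _ _] := params_ok.
have [s [xbar [si cvg_x]]] := compact_subsequence compD ptD.
have cph := cvg_Phi (fun i => @cont i xbar) cvg_x.
have d0 : 0 < nu1 c * tau / 2 by rewrite divr_gt0// mulr_gt0.
have /cvgrPdist_lt/(_ _ d0)[L0 _ close] := cph.
pose L := maxn L0 k1.
have k1s : (k1 <= s L)%N := leq_trans (leq_maxr _ _) (increasing_seq_ge L si).
exists (s L) => // k sk nrej.
have [_ _ le] := late_accepted (leq_trans k1s sk) nrej.
pose L' := maxn L0 k.+1.
have kL' : (k.+1 <= s L')%N := leq_trans (leq_maxr _ _) (increasing_seq_ge L' si).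
have := close L (leq_maxl _ _); have := close L' (leq_maxl _ _).
have := late_Phi_noninc k1s sk.
have := late_Phi_noninc (leqW (leq_trans k1s sk)) kL'.
rewrite /= !ltr_norml /Phi_at in le * => ? ? /andP[? ?] /andP[? ?].
by rewrite -(ltr_pM2l nu1_gt0); lra.
Qed.

Lemma late_rads_vanish N0 (tau : R) : (k1 <= N0)%N ->
  (forall k, (N0 <= k)%N -> rejected S r k) -> 0 < tau ->
  exists2 N, (N0 <= N)%N & forall k, (N <= k)%N -> rads r k 0 < tau.
Proof.
move=> k1N rej tau0; have [_ [g0 g01 g1 _] _ _ _] := params_ok.
have gp : 0 < gamma1 c by apply: lt_le_trans g01.
have geo l : rads r (N0 + l) 0 <= gamma1 c ^+ l * rads r N0 0.
  elim: l => [|l IH]; first by rewrite addn0 mul1r.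
  rewrite addnS exprS -mulrA.
  have N0l : (N0 <= N0 + l)%N by exact: leq_addr.
  have [_ le] := late_rejected (leq_trans k1N N0l) (rej _ N0l).
  by apply: le_trans le _; rewrite ler_wpM2l// ltW.
have : gamma1 c ^+ l @[l --> \oo] --> (0 : R).
  by apply: cvg_expr; rewrite ger0_norm// ltW.
have q0 : 0 < tau / rads r N0 0 by rewrite divr_gt0.
move=> /cvgrPdist_lt/(_ _ q0)[L _ close].
exists (N0 + L)%N; first exact: leq_addr.
move=> k /subnKC <-; rewrite -addnA; apply: le_lt_trans (geo _) _.
rewrite -ltr_pdivlMr//; have := close (L + (k - (N0 + L)))%N (leq_addr _ _).
by rewrite sub0r normrN ger0_norm// exprn_ge0// ltW.
Qed.

Lemma eventually_rejected :
  ~ (forall N, exists2 k, (N <= k)%N & ~~ rejected S r k) ->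
  exists N, forall k, (N <= k)%N -> rejected S r k.
Proof.
move=> fin; apply: contrapT => none; apply: fin => N; apply: contrapT => nacc.
apply: none; exists N => k Nk; apply/negPn/negP => acc.
by apply: nacc; exists k.
Qed.

(** If acceptances recur, sufficient decrease bounds theta^psi by vanishing model decreases.
    Otherwise perpetual rejection shrinks the radii to 0, and theta = O(D^e). *)
Lemma late_theta_small (tau : R) : 0 < tau -> exists2 N, (k1 <= N)%N &
  forall k, (N <= k)%N -> theta_at S r k < tau.
Proof.
move=> tau0.
have [inf|fin] := pselect (forall N, exists2 k, (N <= k)%N & ~~ rejected S r k).
  have kt0 : 0 < kappa_theta c * tau `^ psi c by rewrite mulr_gt0// powR_gt0.
  have [N k1N dec] := late_decrease_small kt0; exists N => // k Nk.
  have accepted j : (N <= j)%N -> ~~ rejected S r j -> theta_at S r j < tau.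
    move=> Nj acc; have [_ suff _] := late_accepted (leq_trans k1N Nj) acc.
    have := le_lt_trans suff (dec j Nj acc); rewrite ltr_pM2l//.
    apply: contraLR; rewrite -!leNgt => le.
    by rewrite ge0_ler_powR ?nnegrE ?(ltW psi_gt0)// ltW.
  (* Induction on the distance to a later accepted iteration [k']; rejections do not change
     theta. *)
  have [k' kk' acc] := inf k; move: acc; rewrite -(subnKC kk').
  move: (k' - k)%N => d; elim: d k Nk {kk'} => [|d IH] k Nk.
    by rewrite addn0; exact: accepted.
  rewrite addnS -addSn => /(IH k.+1 (leqW Nk)) small.
  have [rej|] := boolP (rejected S r k); last exact: accepted.
  by move: small; rewrite /theta_at (late_rejected (leq_trans k1N Nk) rej).1.
have [N0 rej] := eventually_rejected fin.
have [t t0 small] := @powR_dominated R (2 * C / tau) e 0 e_gt0.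
have [|N N0N vanish] := @late_rads_vanish (maxn k1 N0) t (leq_maxl _ _) _ t0.
  by move=> k; rewrite geq_max => /andP[_]; exact: rej.
have k1N := leq_trans (leq_maxl _ _) N0N.
exists N => // k Nk; have k1k := leq_trans k1N Nk.
have /andP[r0 rr] := rad_bounds k.
have := small (rad r k); rewrite r0 (ltW (le_lt_trans rr (vanish k Nk))).
rewrite powRr0 mulrAC ler_pdivrMr// mul1r => /(_ isT) le.
have := theta_le_rad (late_compatible k1k); have := powR_ge0 (rad r k) e.
by have := theta0 k; lra.
Qed.

(** Feasible points never enter the filter: with theta = 0 an incompatible step would force radius
    0, and a compatible one has a nonnegative model decrease, which is then sufficient. *)
Lemma filter_theta_gt0 k p : p \in filter_at r k -> 0 < p.1.
Proof.
elim: k p => [|k IH] p; first by rewrite filter0.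
have [Z|/no_filter_step[_ ->]] := pselect (filter_iteration k); last exact: IH.
rewrite filter_step// inE => /orP[/eqP ->|]; last first.
  by rewrite mem_filter => /andP[_]; exact: IH.
rewrite /= lt_neqAle theta_ge0 andbT; apply/eqP => /esym t0.
have {}t0 : theta_at S r k = 0 := t0.
have td : theta_at S r k <= delta_n by rewrite t0 ltW.
have [ck|nck] := pselect (compat k); last first.
  have := incompatible_radius nck td.
  by rewrite t0 mulr0 leNgt powR_gt0.
have [_ /negP] := Z ck; apply; rewrite /sufficient_decrease t0 powR0 ?gt_eqF//.
rewrite mulr0; apply: le_trans (decrease_theta ck td); rewrite t0 mulr0 subr0.
have ac : 0 <= a * chi r k by rewrite mulr_ge0 ?(ltW a_gt0) ?chi_ge0//; left.
by rewrite mulr_ge0// !le_min ac ler01 (ltW (rad_gt0 k)).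
Qed.

Lemma filter_theta_lower k : exists2 m : R, 0 < m &
  forall p, p \in filter_at r k -> m <= p.1.
Proof.
have := @filter_theta_gt0 k; elim: (filter_at r k) => [|q F IH] pos.
  by exists 1.
have [|m m0 mF] := IH; first by move=> p pF; apply: pos; rewrite inE pF orbT.
exists (Num.min m q.1); first by rewrite lt_min m0 pos// inE eqxx.
by move=> p; rewrite inE ge_min => /orP[/eqP ->|/mF ->//]; rewrite lexx orbT.
Qed.

Lemma finitely_many_filter_iterations_false : False.
Proof.
have [tau tau0 small_step] := small_radius_step eps_gt0.
have [m m0 mF] := filter_theta_lower k1.
have [_ [g0 g01 g1 _] [_ nu10 _] _ [_ [/andP[B0 _] _ _ _ _]]] := params_ok.
have /andP[gam0 gam1] := gamma01.
(* For radii up to [t], at most 1, the trial theta is at most C t, hence below [1 - gamma_theta]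
   times every filter entry; the fixed filter cannot reject such steps. *)
pose t := Num.min (Num.min tau 1) ((1 - gamma_theta c) * m / C).
have t0 : 0 < t by rewrite !lt_min tau0 ltr01 divr_gt0// mulr_gt0// subr_gt0.
have thr0 : 0 < Num.min eps delta_n by rewrite lt_min eps_gt0.
have [N1 k1N1 thsmall] := late_theta_small thr0.
pose N := maxn N1 k0.
have late k : (N <= k)%N ->
    [/\ (k1 <= k)%N, theta_at S r k <= delta_n & eps <= chi r k].
  rewrite geq_max => /andP[N1k k0k].
  have := thsmall k N1k; rewrite lt_min => /andP[te td].
  by split; [exact: leq_trans N1k|exact: ltW|exact: chi_ge_eps].
have grow k : (N <= k)%N -> rad r k <= t -> rad r k <= rads r k.+1 0.
  move=> Nk; rewrite !le_min -andbA => /and3P[rtau r1 rm].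
  have [k1k td chik] := late k Nk; have ck := late_compatible k1k.
  have [suff rho0 drop] := small_step k ck chik rtau.
  have acc : acceptable S (xs r k) ((theta_at S r k, Phi_at S r k) :: filter_at r k).
    apply: acceptable_pair => //; apply/allP => p; rewrite late_filter// => /mF mp.
    apply/orP; left; apply: le_trans (theta_xs_le ck) _.
    rewrite (@le_trans _ _ ((1 - gamma_theta c) * m))//; last first.
      by rewrite ler_wpM2l// subr_ge0 ltW.
    rewrite -ler_pdivlMl// mulrC; apply: le_trans rm.
    by rewrite expr2 ler_piMl// ltW.
  have nrej : ~~ rejected S r k.
    by apply/negP => rej; have := rejectedP rej suff rho0; rewrite acc.
  have [/(_ ck)[_ _ +] _] := iterations k.
  rewrite /acceptance_step (negPf nrej) => -[_ _].
  by rewrite ltNge rho0 /= => /andP[].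
(* A radius up to [t] is not reduced by the step, a larger one not below [gamma0 * t], and the
   Criticality Routine goes no lower than the smaller of the preliminary radius and [cB * chi]. *)
pose d := Num.min (rad r N) (Num.min (gamma0 c * t) (cB c * eps)).
have d0 : 0 < d by rewrite !lt_min rad_gt0 !mulr_gt0.
have rad_ge k : (N <= k)%N -> d <= rad r k.
  move=> /subnKC <-; elim: (k - N)%N => [|l IH].
    by rewrite addn0 /d ge_min lexx.
  have Nk : (N <= N + l)%N := leq_addr _ _.
  rewrite addnS; have [k1k _ chik] := late _ (leqW Nk).
  apply: le_trans (rad_ge_chi (late_compatible k1k)); rewrite le_min; apply/andP; split.
    have [small|big] := leP (rad r (N + l)) t.
      exact: le_trans (grow _ Nk small).
    have [k1k' _ _] := late _ Nk.
    apply: le_trans (radius_step (late_compatible k1k')).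
    by rewrite /d !ge_min ler_pM2l// (ltW big) !orbT.
  by rewrite /d !ge_min (ler_pM2l B0) chik !orbT.
have [inf|fin] := pselect (forall N, exists2 k, (N <= k)%N & ~~ rejected S r k).
  have [z z0 dec] := decrease_bound d0.
  have [|N2 k1N2 md_small] := @late_decrease_small (z / 2); first by rewrite divr_gt0.
  have [|N3 k1N3 th_small] := @late_theta_small (z / (2 * C)).
    by rewrite divr_gt0// mulr_gt0.
  (* At a late accepted iteration the model decrease and C theta are both below [z / 2], although
     their sum is at least [z]. *)
  have [k + acc] := inf (maxn N (maxn N2 N3)).
  rewrite !geq_max -geq_max => /and3P[Nk N2k N3k].
  have [k1k td chik] := late k Nk.
  have := dec k (late_compatible k1k) td chik (rad_ge k Nk).
  have := md_small k N2k acc; have := th_small k N3k.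
  by rewrite invfM mulrA ltr_pdivlMr// (mulrC _ C); lra.
have [N0 rej] := eventually_rejected fin.
have [||N' N'N vanish] := @late_rads_vanish (maxn N N0) d _ _ d0.
- exact: leq_trans (leq_trans k1N1 (leq_maxl _ _)) (leq_maxl _ _).
- by move=> k; rewrite geq_max => /andP[_]; exact: rej.
have := rad_ge _ (leq_trans (leq_maxl _ _) N'N); have := vanish _ (leqnn _).
by case/andP: (rad_bounds N'); lra.
Qed.

End FinitelyManyFilterIterations.

Lemma not_quasi_stationary_false : False.
Proof.
have [inf|fin] := pselect (forall N, exists2 k, (N <= k)%N & filter_iteration k).
  exact: infinitely_many_filter_iterations_false.
apply: fin => N; apply: contrapT => none.
apply: (@finitely_many_filter_iterations_false N) => k Nk Zk.
by apply: none; exists k.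
Qed.

End NotQuasiStationary.

(** With [eps_theta] positive, small theta and chi lie below the thresholds of the criticality test,
    so [final_radius_small] bounds the radius if the step is compatible, and [incompatible_radius]
    if not. *)
Lemma small_radius (tau : R) : 0 < eps_theta c -> 0 < tau ->
  exists2 eta, 0 < eta & forall k, theta_at S r k < eta -> chi r k < eta ->
    rad r k <= tau.
Proof.
move=> et0 tau0; have te0 : 0 < tau `^ e by exact: powR_gt0.
have [_ _ _ [/andP[ec0 _] _] [_ [/andP[B0 BM] _ _ _ _]]] := params_ok.
have M0 := lt_trans B0 BM.
exists (Num.min (Num.min (eps_theta c) (eps_chi c))
          (Num.min delta_n (Num.min (tau / cM c) (tau `^ e / C)))).
  by rewrite !lt_min et0 ec0 delta_n_gt0 !divr_gt0.
move=> k; rewrite !lt_min -!andbA.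
move=> /and5P[t1 _ t3 _ t5] /and5P[_ c2 _ c4 _].
have powle (u : R) : 0 <= u -> u `^ e <= C * theta_at S r k -> u <= tau.
  move=> u0 le; rewrite leNgt; apply/negP => lt.
  have : tau `^ e <= u `^ e by rewrite ge0_ler_powR ?nnegrE ?(ltW e_gt0)// ltW.
  move=> /le_trans/(_ le); apply/negP; rewrite -ltNge.
  by rewrite mulrC -ltr_pdivlMr.
have [ck|nck] := pselect (compat k).
  have [le|le] := final_radius_small ck t1 c2; last exact: powle (ltW (rad_gt0 k)) le.
  by apply: le_trans le _; rewrite mulrC -ler_pdivlMr// ltW.
have [_ /(_ nck)[_ -> _ _ _]] := iterations k.
by apply: powle (ltW (rads_gt0 k)) _; exact: incompatible_radius (ltW t3).
Qed.

Lemma quasi_stationary : quasi_stationary_subsequence S x (chi r) (rad r).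
Proof.
(* The bound by [delta_n] guarantees a nonnegative chi also at incompatible iterations, so that its
   upper bounds give the limit 0. *)
pose G l k := [/\ theta_at S r k <= delta_n, theta_at S r k < l.+1%:R^-1
                & chi r k < l.+1%:R^-1].
have [l N|s si sG] := @increasing_choice G.
  apply: contrapT => none.
  have eps0 : 0 < Num.min delta_n l.+1%:R^-1.
    by rewrite lt_min delta_n_gt0 invr_gt0 ltr0n.
  apply: (@not_quasi_stationary_false _ N eps0) => k Nk.
  have [le|lt] := lerP (Num.min delta_n l.+1%:R^-1) (theta_at S r k).
    by left.
  right; rewrite leNgt; apply/negP => clt; apply: none; exists k => //.
  by move: lt clt; rewrite !lt_min => /andP[/ltW ? ?] /andP[].
have [t [xbar [ti cvg_x]]] := compact_subsequence compD (fun l => ptD (s l)).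
have inv_small (eta : R) : 0 < eta -> \forall l \near \oo, (t l).+1%:R^-1 < eta.
  move=> eta0; near=> l; apply: (@le_lt_trans _ _ l.+1%:R^-1).
    by rewrite lef_pV2 ?posrE// ler_nat ltnS increasing_seq_ge.
  by near: l; exact: (near_infty_natSinv_lt (PosNum eta0)).
have to0 (u : nat -> R) : (forall l, 0 <= u (s (t l))) ->
    (forall l, u (s (t l)) < (t l).+1%:R^-1) -> u \o (s \o t) @ \oo --> (0 : R).
  move=> u0 ult; apply/cvgrPdist_lt => eta eta0; near=> l.
  rewrite sub0r normrN ger0_norm ?u0//= (lt_trans (ult l))//.
  by near: l; exact: inv_small.
have cth := cvg_theta (fun i => @cont i xbar) cvg_x.
have th0 : theta_at S r \o (s \o t) @ \oo --> (0 : R).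
  by apply: to0 => l; [exact: theta0|have [] := sG (t l)].
exists (s \o t), xbar; split => //.
- exact: increasing_seq_comp.
- by split=> //; exact: cvg_unique cth th0.
- by apply: to0 => l; have [td _ ct] := sG (t l); [apply: chi_ge0; right|].
- move=> et0; apply/cvgrPdist_le => eta eta0.
  have [zeta zeta0 small] := small_radius et0 eta0.
  near=> l; rewrite sub0r normrN ger0_norm ?(ltW (rad_gt0 _))//=.
  have lz : (t l).+1%:R^-1 < zeta by near: l; exact: inv_small.
  by have [_ tz cz] := sG (t l); apply: small; exact: lt_trans lz.
Unshelve. all: by end_near. Qed.

End InfiniteRun.

(** * Step estimates for the algorithm *)

Section TangentialProblem.
Context {R : realType} {n K M P : nat}.
Local Notation V := 'rV[R]_n.
Implicit Types (m : mop R n K M P) (x y v d : V) (N : V -> R).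

Lemma lin_set_scale m x y d (t : R) : 0 <= t <= 1 ->
  lin_set m x y -> lin_set m x (y + d) -> lin_set m x (y + t *: d).
Proof.
move=> /andP[t0 t1] [yE yI] [dE dI].
have split_step : y + t *: d - x = (1 - t) *: (y - x) + t *: (y + d - x).
  apply/rowP => i; rewrite !mxE; ring.
rewrite /lin_set /= split_step !mulmxDl -!scalemxAl.
have comb q (a : 'rV[R]_q) u w : a + ((1 - t) *: u + t *: w) =
    (1 - t) *: (a + u) + t *: (a + w).
  by rewrite !scalerDr addrACA -scalerDl subrK scale1r.
rewrite !comb yE dE !scaler0 addr0; split => // l.
rewrite mxE [X in X + _]mxE [X in _ + X]mxE.
by rewrite -[leRHS]addr0 lerD ?mulr_ge0_le0 ?subr_ge0.
Qed.

Lemma tan_feasible0 m x y N : N 0 = 0 -> lin_set m x y ->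
  tan_feasible m x y N 0 0.
Proof.
by move=> N0 ly; split; [move=> l; rewrite mul0mx mxE|rewrite addr0|rewrite N0].
Qed.

Lemma omega_ge0 m x y N : N 0 = 0 -> lin_set m x y -> 0 <= omega m x y N.
Proof.
move=> N0 ly; rewrite /omega oppr_ge0.
have f0 := tan_feasible0 N0 ly.
set B := [set _ | _]; have B0 : B 0 by exists 0.
(* Without a lower bound the infimum takes its default value 0, which also satisfies the claim. *)
have [lb|nlb] := pselect (has_lbound B); first exact: ge_inf.
by rewrite inf_out// => -[_ /nlb].
Qed.

Lemma crit_measure_ge0 m x y N : N 0 = 0 -> lin_set m x y ->
  0 <= crit_measure m x y N.
Proof. by move=> N0 ly; rewrite /crit_measure le_min ler01 omega_ge0. Qed.

(** Dividing a feasible pair by [a] makes it feasible for the other norm. Applied to the minimizer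
    this bounds the infimum for [N']; applied in the other direction it shows that this infimum is
    taken over a set bounded below. *)
Lemma omega_norm_le m x y N N' (a : R) d : 1 <= a ->
  (forall t v, 0 <= t -> N (t *: v) = t * N v) ->
  (forall t v, 0 <= t -> N' (t *: v) = t * N' v) ->
  (forall v, N v <= a * N' v) -> (forall v, N' v <= a * N v) ->
  lin_set m x y -> tan_minimizer m x y N d ->
  omega m x y N <= a * omega m x y N'.
Proof.
move=> a1 NZ N'Z NN' N'N ly [b bfeas bmin].
have a0 : 0 < a by apply: lt_le_trans a1.
have ai : 0 <= a^-1 <= 1 by rewrite invr_ge0 ltW//= invf_le1.
have shrink (N1 N2 : V -> R) b' d' :
    (forall t v, 0 <= t -> N2 (t *: v) = t * N2 v) ->
    (forall v, N2 v <= a * N1 v) ->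
    tan_feasible m x y N1 b' d' -> tan_feasible m x y N2 (a^-1 * b') (a^-1 *: d').
  move=> N2Z N21 [obj_le lin nrm]; case/andP: (ai) => ai0 ai1; split.
  - by move=> l; rewrite -scalemxAl mxE ler_wpM2l.
  - exact: lin_set_scale.
  - rewrite N2Z// ler_pdivrMl// mulr1 (le_trans (N21 _))//.
    by rewrite ler_piMr// ltW.
have infN : inf [set b | exists d, tan_feasible m x y N b d] = b.
  apply/eqP; rewrite eq_le; apply/andP; split.
    apply: ge_inf; last by exists d.
    by exists b => b' [d' /bmin].
  apply: lb_le_inf; first by exists b, d.
  by move=> b' [d' /bmin].
have infN' : inf [set b | exists d, tan_feasible m x y N' b d] <= a^-1 * b.
  apply: ge_inf; last by exists (a^-1 *: d); exact: shrink bfeas.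
  exists (a * b) => b' [d' /(shrink N' N _ _ NZ NN')/bmin].
  by rewrite ler_pdivlMl.
by rewrite /omega infN mulrN lerN2 -ler_pdivlMl.
Qed.

End TangentialProblem.

(** * Fully linear interpolating models around one iterate *)

Section LocalModels.
Context {R : realType} {n K M P : nat}.
Local Notation V := 'rV[R]_n.
Variables (S : setting R n K M P) (r : run R n K M P).
Variables (cc G0 : R).
Hypothesis norms : forall k, is_norm (norm_tr S k) /\ is_norm (norm_pb S k).
Hypothesis cc_ge1 : 1 <= cc.
Hypothesis norm_equiv : forall k N, N = norm_tr S k \/ N = norm_pb S k ->
  forall y : V, cc^-1 * N y <= norm2 y <= cc * N y.
Hypothesis fl_pos : [/\ 0 < fl_val S, 0 < fl_grad S & 0 < fl_lip S].
Hypothesis rads_bounds : forall k, reached r k ->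
  0 < rads r k 0 < Delta_max (par S).
Hypothesis grad_bound : forall i y, domC S r y ->
  norm2 (grad (component (prob S) i) y) <= G0.

Let cc_gt0 : 0 < cc. Proof. exact: lt_le_trans cc_ge1. Qed.

Lemma norm_tr0 k : norm_tr S k 0 = 0.
Proof. by have [[_ NZ _] _] := norms k; rewrite -(scale0r 0) NZ normr0 mul0r. Qed.

Lemma norm_pb0 k : norm_pb S k 0 = 0.
Proof. by have [_ [_ NZ _]] := norms k; rewrite -(scale0r 0) NZ normr0 mul0r. Qed.

Lemma norm2_le_tr k v : norm2 v <= cc * norm_tr S k v.
Proof. by have /(_ v)/andP[] := norm_equiv (or_introl (erefl (norm_tr S k))). Qed.

Lemma norm_tr_ge0 k v : 0 <= norm_tr S k v.
Proof.
rewrite -(pmulr_rge0 _ cc_gt0); exact: le_trans (norm2_ge0 _) (norm2_le_tr k v).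
Qed.

Lemma ball_domC k v t : reached r k -> norm_tr S k v <= rads r k 0 ->
  0 <= t <= 1 -> domC S r (pt r k + t *: v).
Proof.
move=> rk Nv /andP[t0 t1]; exists k => //=.
rewrite /ball_at /nball /= (addrC (pt r k)) addrK; have [[_ NZ _] _] := norms k.
by rewrite NZ ger0_norm// (le_trans _ Nv)// ler_piMl// norm_tr_ge0.
Qed.

Lemma step_domC k v : reached r k -> norm_tr S k v <= rads r k 0 ->
  domC S r (pt r k + v).
Proof.
by move=> rk Nv; rewrite -[v]scale1r; apply: ball_domC => //; rewrite ler01 lexx.
Qed.

Lemma pt_domC k : reached r k -> domC S r (pt r k).
Proof.
move=> rk; rewrite -[pt r k]addr0; apply: step_domC => //.
by rewrite norm_tr0 ltW//; have /andP[] := rads_bounds rk.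
Qed.

(** Covers both the final model of an iteration and the inner models of an endless Criticality
    Routine. *)
Definition local_model k m Delta : Prop :=
  [/\ reached r k, 0 <= Delta <= rads r k 0, fully_linear_mop S r k m Delta
    & forall i, component m i (pt r k) = component (prob S) i (pt r k)].

(** These constants bound, in turn, model gradients at the iterate, the change of a model per length
    of step, and theta at a trial point per squared radius. *)
Definition grad_const : R := G0 + fl_grad S * Delta_max (par S).
Definition lip_const : R := grad_const + fl_lip S * (cc * Delta_max (par S)).
Definition trial_const : R := fl_val S + fl_lip S * cc ^+ 2.

Lemma model_grad_le k m Delta i : local_model k m Delta ->
  norm2 (grad (component m i) (pt r k)) <= grad_const.
Proof.
move=> [rk /andP[D0 D1] /(_ i)[_ _ fl] _]; have xC := pt_domC rk.
have [|gle _] := fl (pt r k).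
  by split => //; rewrite /nball /= subrr norm_tr0.
have -> : grad (component m i) (pt r k) = grad (component (prob S) i) (pt r k)
    + (grad (component m i) (pt r k) - grad (component (prob S) i) (pt r k)).
  by rewrite addrC subrK.
apply: le_trans (norm2D _ _) _; rewrite lerD ?grad_bound// norm2_subC.
apply: le_trans gle _; have [_ g0 _] := fl_pos; rewrite ler_wpM2l// ?(ltW g0)//.
by have /andP[_ /ltW] := rads_bounds rk; exact: le_trans.
Qed.

Lemma grad_const_ge0 k m Delta : local_model k m Delta -> 0 <= grad_const.
Proof.
by move=> /(@model_grad_le _ _ _ (inl (inl ord0))); apply: le_trans; exact: norm2_ge0.
Qed.

Lemma model_taylor k m Delta i v : local_model k m Delta ->
  norm_tr S k v <= rads r k 0 ->
  `|component m i (pt r k + v) - component m i (pt r k) -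
    inner v (grad (component m i) (pt r k))| <= fl_lip S * norm2 v ^+ 2.
Proof.
move=> [rk _ /(_ i)[dm lip _] _] Nv; have [_ _ L0] := fl_pos.
apply: taylor_lip lip _ dm; first exact: ltW.
by move=> t t01; exact: ball_domC.
Qed.

Lemma norm2_step_le k v b : norm_tr S k v <= b -> norm2 v <= cc * b.
Proof. by move=> Nv; rewrite (le_trans (norm2_le_tr k v))// ler_wpM2l// ltW. Qed.

Lemma model_lipschitz k m Delta i v : local_model k m Delta ->
  norm_tr S k v <= rads r k 0 ->
  `|component m i (pt r k + v) - component m i (pt r k)| <= lip_const * norm2 v.
Proof.
move=> mk Nv; have tay := model_taylor i mk Nv; have gle := model_grad_le i mk.
have [rk _ _ _] := mk; have [_ _ L0] := fl_pos.
have cs := inner_le_norm2 v (grad (component m i) (pt r k)).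
set D := inner _ _ in tay cs; set A := _ - component _ _ _ in tay *.
have -> : A = (A - D) + D by rewrite subrK.
apply: le_trans (ler_normD _ _) _; apply: le_trans (lerD tay cs) _.
have v0 := norm2_ge0 v; rewrite expr2 mulrA (mulrC (norm2 v)) -mulrDl.
rewrite ler_wpM2r// /lip_const addrC lerD// ler_wpM2l ?(ltW L0)//.
apply: (norm2_step_le (k := k)); apply: le_trans Nv _.
by have /andP[_ /ltW] := rads_bounds rk.
Qed.

Lemma Phi_model_lipschitz k m Delta v : local_model k m Delta ->
  norm_tr S k v <= rads r k 0 ->
  `|Phi m (pt r k + v) - Phi m (pt r k)| <= lip_const * norm2 v.
Proof.
by move=> mk Nv; apply: Phi_dist => l; exact: (model_lipschitz (inl (inl l)) mk).
Qed.

Lemma linearization_le k m Delta v : local_model k m Delta ->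
  lin_set m (pt r k) (pt r k + v) ->
  (forall l, component m (inl (inr l)) (pt r k) +
     inner v (grad (component m (inl (inr l))) (pt r k)) = 0) /\
  (forall l, component m (inr l) (pt r k) +
     inner v (grad (component m (inr l)) (pt r k)) <= 0).
Proof.
move=> [rk _ fl _]; rewrite /lin_set /= (addrC (pt r k)) addrK => -[eq0 le0].
have xC := pt_domC rk; split=> l.
  have /rowP/(_ l) := eq0; rewrite [LHS]mxE [RHS]mxE => e0; rewrite -[RHS]e0.
  congr (_ + _); rewrite -(mulmx_jacobian (F := eqc m))// => j.
  by have [dm _ _] := fl (inl (inr j)); exact: dm.
apply: le_trans (le0 l); rewrite mxE lerD2l -(mulmx_jacobian (F := ineq m))//.
by move=> j; have [dm _ _] := fl (inr j); exact: dm.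
Qed.

(** The step cancels the linearized violation of interpolating models, so that violation is at most
    gradient times step length. *)
Lemma theta_le_normal k m Delta v : local_model k m Delta ->
  lin_set m (pt r k) (pt r k + v) ->
  theta (prob S) (pt r k) <= grad_const * norm2 v.
Proof.
move=> mk lin; have [eq0 le0] := linearization_le mk lin.
have dle i : `|inner v (grad (component m i) (pt r k))| <= grad_const * norm2 v.
  apply: le_trans (inner_le_norm2 _ _) _.
  by rewrite mulrC ler_wpM2r ?norm2_ge0// (model_grad_le _ mk).
have [_ _ _ interp] := mk.
apply: theta_le => [|l|l].
- by rewrite mulr_ge0 ?norm2_ge0// (grad_const_ge0 mk).
- have := dle (inl (inr l)); have /eqP := eq0 l; rewrite addrC addr_eq0 => /eqP ->.
  by rewrite normrN interp.
- have := dle (inr l); have := le0 l; rewrite interp /= ler_norml.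
  by move=> ? /andP[]; lra.
Qed.

Lemma trial_const_ge0 : 0 <= trial_const.
Proof.
by have [/ltW v0 _ /ltW l0] := fl_pos; rewrite addr_ge0// mulr_ge0// sqr_ge0.
Qed.

(** The linearized constraints hold at the trial point; what remains is the Taylor remainder of the
    model plus the model error, both quadratic in the radius. *)
Lemma theta_trial_le k m Delta v : local_model k m Delta ->
  lin_set m (pt r k) (pt r k + v) -> norm_tr S k v <= Delta ->
  theta (prob S) (pt r k + v) <= trial_const * Delta ^+ 2.
Proof.
move=> mk lin Nv; have [eq0 le0] := linearization_le mk lin.
have [rk /andP[D0 D1] fl interp] := mk.
have Nv' := le_trans Nv D1.
have yC := step_domC rk Nv'; have [_ _ L0] := fl_pos.
have quad : fl_lip S * norm2 v ^+ 2 <= fl_lip S * cc ^+ 2 * Delta ^+ 2.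
  rewrite -mulrA -exprMn ler_wpM2l ?(ltW L0)//.
  rewrite ler_pXn2r ?nnegrE ?norm2_ge0 ?mulr_ge0 ?(ltW cc_gt0)//.
  exact: (norm2_step_le Nv).
have val i : `|component (prob S) i (pt r k + v) - component m i (pt r k + v)|
    <= fl_val S * Delta ^+ 2.
  have [_ _ /(_ (pt r k + v))[|_ //]] := fl i.
  by split => //; rewrite /nball /= (addrC (pt r k)) addrK.
have close i : `|component (prob S) i (pt r k + v) -
    (component m i (pt r k) + inner v (grad (component m i) (pt r k)))|
    <= trial_const * Delta ^+ 2.
  have tay := model_taylor i mk Nv'; have vi := val i.
  rewrite /trial_const mulrDl; apply: le_trans (lerD vi (le_trans tay quad)).
  apply: le_trans (ler_normD _ _); rewrite le_eqVlt; apply/orP; left; apply/eqP.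
  by congr `|_|; ring.
apply: theta_le => [|l|l].
- by rewrite mulr_ge0 ?sqr_ge0// trial_const_ge0.
- by have := close (inl (inr l)); rewrite eq0 subr0.
- have := close (inr l); have := le0 l; rewrite ler_norml /= => ? /andP[_].
  by lra.
Qed.

Lemma Phi_trial_le k m Delta v : local_model k m Delta -> norm_tr S k v <= Delta ->
  `|Phi (prob S) (pt r k + v) - Phi m (pt r k + v)| <= fl_val S * Delta ^+ 2.
Proof.
move=> [rk /andP[D0 D1] fl _] Nv; apply: Phi_dist => l.
have [_ _ /(_ (pt r k + v))[|_ //]] := fl (inl (inl l)).
split; first by rewrite /nball /= (addrC (pt r k)) addrK.
exact: step_domC rk (le_trans Nv D1).
Qed.

Lemma Phi_interpolates k m Delta : local_model k m Delta ->
  Phi m (pt r k) = Phi (prob S) (pt r k).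
Proof.
move=> [_ _ _ interp]; rewrite /Phi.
have e l := interp (inl (inl l)); rewrite /= in e.
by rewrite e; apply: eq_bigr => l _; exact: e.
Qed.

(** * Hypotheses on the run and the compatibility condition *)

Variables (delta_n c_ubn c_sd W : R).
Local Notation c := (par S).
Local Notation x := (pt r).
Hypothesis params_ok : valid_params c delta_n.
Hypothesis rad_bounds : forall k, completed r k -> 0 < rad r k <= rads r k 0.
Hypothesis final_fl : forall k, completed r k ->
  fully_linear_mop S r k (mod_ r k) (rad r k).
Hypothesis interpolation : forall k j i, built S r k j ->
  component (mods r k j) i (x k) = component (prob S) i (x k).
Hypothesis c_ubn_gt0 : 0 < c_ubn.
Hypothesis normal_bound : forall k j, built S r k j ->
  theta_at S r k <= delta_n ->
  exists2 v, normal_step (mods r k j) (x k) v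
           & norm_tr S k v <= c_ubn * theta_at S r k.
Hypothesis c_sd01 : 0 < c_sd < 1.
Hypothesis W_ge1 : 1 <= W.
Hypothesis decrease : forall k, completed r k -> has_compatible S r k 0 ->
  0 < rad r k < Delta_max c ->
  compatible S k (nstep r k) (rads r k 0) ->
  tan_minimizer (mod_ r k) (x k) (xn r k) (norm_pb S k) (dir r k) ->
  let omega2 := omega (mod_ r k) (x k) (xn r k) (@norm2 R n) in
  [/\ 0 <= sigma r k,
      (lin_set (mod_ r k) (x k) `&` ball_at S r k (rad r k))
        (xn r k + sigma r k *: dir r k)
    & c_sd * omega2 * Num.min (omega2 / W) (Num.min (rad r k) 1)
      <= Phi (mod_ r k) (xn r k)
         - Phi (mod_ r k) (xn r k + sigma r k *: dir r k)].
Hypothesis iterations : forall k, completed r k -> iteration S r k.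

Let e := 1 + mu c.

Lemma mu01 : 0 < mu c < 1.
Proof. by have [_ _ _ _ [_ [_ _ _ _ [_ ?]]]] := params_ok. Qed.

Lemma c_Delta01 : 0 < c_Delta c < 1.
Proof. by have [_ _ _ _ [_ [_ _ _ ? _]]] := params_ok. Qed.

Lemma c_mu_gt0 : 0 < c_mu c.
Proof. by have [_ _ _ _ [_ [_ _ _ _ [? _]]]] := params_ok. Qed.

Lemma alpha01 : 0 < alpha c < 1.
Proof. by have [_ _ _ _ [_ [_ ? _ _ _]]] := params_ok. Qed.

Lemma cBM : 0 < cB c < cM c.
Proof. by have [_ _ _ _ [_ [? _ _ _ _]]] := params_ok. Qed.

Lemma completed_reached k : completed r k -> reached r k.
Proof. by rewrite /completed /reached; case: result => // [? ?|?] /ltnW. Qed.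

Lemma powR1D (t : R) : 0 < t -> t `^ e = t * t `^ mu c.
Proof.
by move=> t0; rewrite /e powRD ?(gt_eqF t0) ?implybT// powRr1// ltW.
Qed.

Lemma compatible_mono k v t u : 0 < t <= u -> compatible S k v t ->
  compatible S k v u.
Proof.
move=> /andP[t0 tu] /le_trans; apply.
have /andP[cD _] := c_Delta01; have cm := c_mu_gt0; have /andP[m0 _] := mu01.
have min0 s : 0 <= Num.min 1 (c_mu c * s `^ mu c).
  by rewrite le_min ler01 mulr_ge0 ?powR_ge0// ltW.
rewrite ler_pM// ?mulr_ge0 ?(ltW t0) ?(ltW cD)//; first by rewrite ler_wpM2l// ltW.
rewrite le_min ge_min lexx /= ge_min; apply/orP; right.
rewrite ler_wpM2l ?(ltW cm)// ge0_ler_powR ?(ltW m0)// nnegrE ltW//.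
exact: lt_le_trans tu.
Qed.

Lemma compatible_le k v t : 0 < t -> compatible S k v t ->
  norm_tr S k v <= t /\ norm_tr S k v <= c_Delta c * c_mu c * t `^ e.
Proof.
move=> t0 comp; have /andP[cD cD1] := c_Delta01; have cm := c_mu_gt0.
have ct : 0 <= c_Delta c * t by rewrite mulr_ge0// ltW.
split; apply: le_trans comp _.
  apply: (@le_trans _ _ (c_Delta c * t)); last by rewrite ler_piMl// ltW.
  by rewrite ler_piMr// ge_min lexx.
rewrite powR1D// mulrACA.
by rewrite ler_wpM2l// ge_min lexx orbT.
Qed.

(** For t up to [Delta_max], the smaller of Delta_max^(-mu) and c_mu, times t^mu, stays below both
    branches of the minimum, which reduces compatibility to one power of t. *)
Lemma compatible_intro k v t : 0 < t <= Delta_max c ->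
  norm_tr S k v <= c_Delta c * Num.min (Delta_max c `^ mu c)^-1 (c_mu c) * t `^ e ->
  compatible S k v t.
Proof.
move=> /andP[t0 tD] /le_trans; apply; have /andP[cD _] := c_Delta01.
have /andP[m0 _] := mu01; have D0 := lt_le_trans t0 tD.
rewrite powR1D// -mulrA -[leRHS]mulrA ler_wpM2l ?(ltW cD)//.
rewrite mulrCA ler_wpM2l ?(ltW t0)// le_min.
have tp : 0 < t `^ mu c by exact: powR_gt0.
have Dp : 0 < Delta_max c `^ mu c by exact: powR_gt0.
apply/andP; split; last by rewrite ler_wpM2r ?(ltW tp)// ge_min lexx orbT.
apply: (@le_trans _ _ ((Delta_max c `^ mu c)^-1 * t `^ mu c)).
  by rewrite ler_wpM2r ?(ltW tp)// ge_min lexx.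
by rewrite ler_pdivrMl// mulr1 ge0_ler_powR ?(ltW m0)// nnegrE ltW.
Qed.

Definition incompatible_const : R :=
  c_ubn / (c_Delta c * Num.min (Delta_max c `^ mu c)^-1 (c_mu c)).

Lemma incompatible_radius k j : built S r k j -> 0 < rads r k j <= Delta_max c ->
  theta_at S r k <= delta_n -> ~ has_compatible S r k j ->
  rads r k j `^ e <= incompatible_const * theta_at S r k.
Proof.
move=> bkj rb small incomp; have [v nv vle] := normal_bound bkj small.
rewrite /incompatible_const -mulrAC ler_pdivlMr; last first.
  have /andP[cD _] := c_Delta01; rewrite mulr_gt0// lt_min c_mu_gt0 andbT invr_gt0.
  by rewrite powR_gt0//; case/andP: rb => r0; exact: lt_le_trans.
rewrite mulrC; apply: le_trans vle; rewrite leNgt; apply/negP => /ltW small_v.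
by apply: incomp; exists v => //; exact: compatible_intro.
Qed.

(** * Estimates for an iteration with a compatible normal step *)

Section CompatibleIteration.
Variable k : nat.
Hypothesis ck : completed r k.
Hypothesis compat : has_compatible S r k 0.

Let rk : reached r k := completed_reached ck.
Let D0 : 0 < rads r k 0. Proof. by have /andP[] := rads_bounds rk. Qed.
Let DM : rads r k 0 < Delta_max c. Proof. by have /andP[] := rads_bounds rk. Qed.

Lemma criticality : criticality_step S r k.
Proof. by have [/(_ compat)[]] := iterations ck. Qed.

Lemma criticality_cases : crit_test S r k /\ routine_terminates S r k \/
  [/\ ~~ crit_test S r k, len r k = 0%N & rad r k = rads r k 0].
Proof.
have := criticality; rewrite /criticality_step.
by case: (boolP (crit_test S r k)) => [ct rt|nct [l0 re]]; [left|right].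
Qed.

Lemma routine_computed j : (j <= len r k)%N -> computed S r k j.
Proof.
have [/(_ compat)[c0 _ _] _] := iterations ck.
case: j => [//|j jl]; have [[_ [pass _ _]]|[_ l0 _]] := criticality_cases.
  by have [] := pass j jl.
by exfalso; rewrite l0 in jl.
Qed.

Lemma routine_built j : (j <= len r k)%N -> built S r k j.
Proof.
case: j => [//|j jl]; have [[ct _]|[_ l0 _]] := criticality_cases.
  by right; exact: (And4 ck compat ct (or_introl jl)).
by exfalso; rewrite l0 in jl.
Qed.

Lemma routine_rads j : (j <= len r k)%N -> rads r k j = alpha c ^+ j * rads r k 0.
Proof.
elim: j => [|j IH] jl; first by rewrite mul1r.
have [[_ [pass _ _]]|[_ l0 _]] := criticality_cases; last by exfalso; rewrite l0 in jl.
by have [[_ -> _] _] := pass j jl; rewrite IH ?(ltnW jl)// exprS mulrA.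
Qed.

Lemma routine_rads_bounds j : (j <= len r k)%N -> 0 < rads r k j <= rads r k 0.
Proof.
move=> jl; have /andP[a0 a1] := alpha01; rewrite routine_rads//.
by rewrite mulr_gt0 ?exprn_gt0// ler_piMl ?(ltW D0)// exprn_ile1 ?ltW.
Qed.

(** The final radius may have been raised to [cB * chi]; bounds obtained at the last loop radius
    therefore carry over. *)
Lemma last_rads_le : rads r k (len r k) <= rad r k.
Proof.
have /andP[_ l0] := routine_rads_bounds (leqnn _).
have [[_ [_ _ ->]]|[_ -> ->]] := criticality_cases; last exact: lexx.
by rewrite le_min l0 le_max lexx.
Qed.

Lemma rad_ge_chi : Num.min (rads r k 0) (cB c * chi r k) <= rad r k.
Proof.
have [[_ [_ _ ->]]|[_ _ ->]] := criticality_cases; last by rewrite ge_min lexx.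
by rewrite minC le_min !ge_min le_max !lexx !orbT.
Qed.

Lemma final_local_model : local_model k (mod_ r k) (rad r k).
Proof.
have /andP[r0 r1] := rad_bounds ck.
split; [exact: rk|by rewrite ltW|exact: final_fl|].
by move=> i; apply: interpolation; exact: routine_built.
Qed.

Lemma nstep_le : norm_tr S k (nstep r k) <= rad r k /\
  norm_tr S k (nstep r k) <= c_Delta c * c_mu c * rad r k `^ e.
Proof.
have /andP[l0 _] := routine_rads_bounds (leqnn _).
have [_ comp _ _] := routine_computed (leqnn _).
have [le1 le2] := compatible_le l0 comp; have ll := last_rads_le.
split; first exact: le_trans ll.
apply: le_trans le2 _; have /andP[cD _] := c_Delta01; have cm := c_mu_gt0.
rewrite ler_wpM2l ?mulr_ge0 ?(ltW cD) ?(ltW cm)//.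
have /andP[m0 _] := mu01.
by rewrite ge0_ler_powR ?nnegrE ?(ltW l0)// ?(ltW (lt_le_trans l0 ll))// addr_ge0// ltW.
Qed.

Lemma nstep_domain : norm_tr S k (nstep r k) <= rads r k 0.
Proof.
have [n1 _] := nstep_le; apply: le_trans n1 _.
by have /andP[] := rad_bounds ck.
Qed.

Lemma nstep_normal : normal_step (mod_ r k) (x k) (nstep r k).
Proof. by have [] := routine_computed (leqnn _). Qed.

Lemma norm2_nstep_le_rad :
  norm2 (nstep r k) <= cc * (c_Delta c * c_mu c) * rad r k `^ e.
Proof. by have [_ n2] := nstep_le; rewrite -mulrA; exact: norm2_step_le n2. Qed.

(** The normal step has least Euclidean length, so it is no longer than the step provided by
    [normal_bound]. *)
Lemma norm2_nstep_le_theta : theta_at S r k <= delta_n ->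
  norm2 (nstep r k) <= cc * c_ubn * theta_at S r k.
Proof.
move=> small; have [v [lv _] vle] := normal_bound (routine_built (leqnn _)) small.
have [_ /(_ v lv)] := nstep_normal.
rewrite ler_pXn2r ?nnegrE ?norm2_ge0// => /le_trans; apply.
by rewrite -mulrA; exact: norm2_step_le vle.
Qed.

Lemma chi_ge0 : 0 <= chi r k.
Proof.
rewrite /chi; have [[lin _] _ _ ->] := routine_computed (leqnn _).
by rewrite crit_measure_ge0// norm_pb0.
Qed.

Lemma theta_le_rad :
  theta_at S r k <= grad_const * (cc * (c_Delta c * c_mu c)) * rad r k `^ e.
Proof.
have [lin _] := nstep_normal; have mk := final_local_model.
apply: le_trans (theta_le_normal mk lin) _.
by rewrite -[leRHS]mulrA ler_wpM2l ?(grad_const_ge0 mk)// norm2_nstep_le_rad.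
Qed.

(** The assumed decrease involves the Euclidean omega, whereas chi uses the problem norm;
    [omega_norm_le] shows that [chi r k / cc] is at most the former. *)
Lemma tangential_decrease :
  [/\ (lin_set (mod_ r k) (x k) `&` ball_at S r k (rad r k)) (xs r k)
    & c_sd * (chi r k / cc) * Num.min (chi r k / cc / W) (Num.min (rad r k) 1)
      <= Phi (mod_ r k) (xn r k) - Phi (mod_ r k) (xs r k)].
Proof.
have [nst comp tan chiE] := routine_computed (leqnn _).
have /andP[r0 r1] := rad_bounds ck.
have [|||_ lin le_dec] := decrease ck compat.
- by rewrite r0 (le_lt_trans r1 DM).
- exact: compatible_mono (routine_rads_bounds (leqnn _)) comp.
- exact: tan.
split => //; apply: le_trans le_dec.
have W0 : 0 < W by apply: lt_le_trans W_ge1.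
have /andP[sd0 _] := c_sd01.
have om : chi r k / cc <= omega (mod_ r k) (x k) (xn r k) (@norm2 R n).
  rewrite ler_pdivrMr// mulrC.
  have [_ [_ NZ _]] := norms k.
  have := @omega_norm_le _ _ _ _ _ (mod_ r k) (x k) (xn r k) (norm_pb S k)
    (@norm2 R n) cc (dir r k) cc_ge1.
  move=> /(_ _ _ _ _ _ tan) om; apply: le_trans (om _ _ _ _ _).
  - by rewrite /chi chiE /crit_measure ge_min lexx orbT.
  - by move=> t v t0; rewrite NZ ger0_norm.
  - by move=> t v t0; rewrite norm2Z ger0_norm.
  - move=> v; have /(_ v)/andP[+ _] := norm_equiv (or_intror (erefl (norm_pb S k))).
    by rewrite ler_pdivrMl.
  - by move=> v; have /(_ v)/andP[] := norm_equiv (or_intror (erefl (norm_pb S k))).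
  - by case: nst.
have q0 : 0 <= chi r k / cc by rewrite divr_ge0 ?chi_ge0// ltW.
have min_ge0 (t : R) : 0 <= t -> 0 <= Num.min (t / W) (Num.min (rad r k) 1).
  by move=> t0; rewrite !le_min ler01 (ltW r0) divr_ge0// ltW.
apply: ler_pM.
- by rewrite mulr_ge0 ?(ltW sd0).
- exact: min_ge0.
- by rewrite ler_wpM2l ?(ltW sd0).
- rewrite le_min; apply/andP; split; rewrite ge_min; apply/orP; [left|by right].
  by rewrite ler_wpM2r ?invr_ge0 ?(ltW W0).
Qed.

Lemma xs_step : xs r k = x k + (nstep r k + sigma r k *: dir r k).
Proof. by rewrite /xs /xn addrA. Qed.

Lemma trial_step_le : norm_tr S k (nstep r k + sigma r k *: dir r k) <= rad r k.
Proof.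
have [[_ +] _] := tangential_decrease.
by rewrite /ball_at /nball /= xs_step (addrC (x k)) addrK.
Qed.

Lemma theta_xs_le : theta (prob S) (xs r k) <= trial_const * rad r k ^+ 2.
Proof.
rewrite xs_step; apply: theta_trial_le final_local_model _ trial_step_le.
by rewrite -xs_step; have [[]] := tangential_decrease.
Qed.

Lemma Phi_xs_dist :
  `|Phi (prob S) (xs r k) - Phi_at S r k + model_decrease r k|
    <= fl_val S * rad r k ^+ 2.
Proof.
have mk := final_local_model.
rewrite /model_decrease (Phi_interpolates mk) addrA subrK xs_step.
exact: Phi_trial_le mk trial_step_le.
Qed.

(** The decrease is split at [xn r k]: the tangential part is bounded below, the normal part by the
    Lipschitz bound of the model. *)
Lemma model_decrease_ge (b : R) : norm2 (nstep r k) <= b ->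
  c_sd * (chi r k / cc) * Num.min (chi r k / cc / W) (Num.min (rad r k) 1)
    - lip_const * b <= model_decrease r k.
Proof.
move=> nb; have mk := final_local_model.
have := Phi_model_lipschitz mk nstep_domain.
rewrite -/(xn r k) => /(le_trans (ler_norm _)) lip.
have [_ dec] := tangential_decrease; rewrite /model_decrease.
have : lip_const * norm2 (nstep r k) <= lip_const * b.
  rewrite ler_wpM2l// addr_ge0 ?(grad_const_ge0 mk)//.
  have [_ _ L0] := fl_pos; rewrite mulr_ge0 ?(ltW L0)// mulr_ge0 ?(ltW cc_gt0)//.
  exact: ltW (lt_trans D0 DM).
by lra.
Qed.

(* Either the loop stops because the radius has dropped below [M chi], or it
   breaks at an incompatible normal step, which bounds the radius by theta. *)
Lemma final_radius_small : theta_at S r k < eps_theta c -> chi r k < eps_chi c ->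
  rad r k <= cM c * chi r k \/
  rad r k `^ e <= (alpha c `^ e)^-1 * incompatible_const * theta_at S r k.
Proof.
move=> tsmall csmall.
have /andP[B0 BM] := cBM; have c0 := chi_ge0.
have Bchi : cB c * chi r k <= cM c * chi r k by rewrite ler_wpM2r// ltW.
have [[ct [_ stop ->]]|[nct l0 ->]] := criticality_cases; last first.
  left; move: nct; rewrite /crit_test tsmall /=.
  by move: csmall; rewrite /chi l0 => -> /=; rewrite -leNgt.
have [small|[pass incomp]] := stop; first by left; rewrite ge_min ge_max small Bchi.
have [leB|ltB] := leP (rads r k (len r k)) (cB c * chi r k).
  by left; rewrite ge_min Bchi.
right; have [Mlt rS _] := pass.
have bS : built S r k (len r k).+1 by right; split => //; right.
have /andP[l0 l1] := routine_rads_bounds (leqnn _).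
have /andP[a0 a1] := alpha01; have /andP[m0 _] := mu01.
have e0 : 0 <= e by rewrite addr_ge0// ltW.
have tn : theta_at S r k <= delta_n.
  by have [_ _ _ [_ /andP[_ ed]] _] := params_ok; rewrite (le_trans (ltW tsmall)).
have rb : 0 < rads r k (len r k).+1 <= Delta_max c.
  rewrite rS mulr_gt0//= (le_trans _ (ltW DM))// (le_trans _ l1)//.
  by rewrite ler_piMl ?ltW.
(* The breaking pass was tried at alpha times the last radius, whence the factor alpha^(-e). *)
have := incompatible_radius bS rb tn incomp.
rewrite rS powRM ?(ltW a0) ?(ltW l0)// -mulrA => inc.
rewrite ler_pdivlMl ?powR_gt0//; apply: le_trans inc.
rewrite ler_wpM2l ?powR_ge0// ge0_ler_powR ?nnegrE ?(ltW l0)//.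
  by rewrite le_min (ltW D0) (ltW l0).
by rewrite ge_min lexx.
Qed.

(** Since c_sd < 1 <= W, this multiple of chi lies below both [c_sd * (chi / cc)] and
    [chi / cc / W], so one constant serves both factors. *)
Definition decrease_const : R := c_sd / (cc * W).

Lemma decrease_const_gt0 : 0 < decrease_const.
Proof.
have /andP[sd0 _] := c_sd01.
by rewrite divr_gt0// mulr_gt0// (lt_le_trans _ W_ge1).
Qed.

Lemma model_decrease_ge_const (b : R) : norm2 (nstep r k) <= b ->
  decrease_const * chi r k *
    Num.min (decrease_const * chi r k) (Num.min (rad r k) 1) - lip_const * b
    <= model_decrease r k.
Proof.
move=> nb; apply: le_trans (model_decrease_ge nb); rewrite lerD2r.
have W0 : 0 < W by apply: lt_le_trans W_ge1.
have /andP[sd0 sd1] := c_sd01; have c0 := chi_ge0; have a0 := decrease_const_gt0.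
have /andP[r0 _] := rad_bounds ck.
have q0 : 0 <= chi r k / cc by rewrite divr_ge0// ltW.
have eq1 : decrease_const * chi r k = c_sd * (chi r k / cc) / W.
  by rewrite /decrease_const; field; rewrite !gt_eqF.
have le1 : decrease_const * chi r k <= c_sd * (chi r k / cc).
  rewrite eq1 ler_pdivrMr// ler_peMr// mulr_ge0// ltW//.
have le2 : decrease_const * chi r k <= chi r k / cc / W.
  by rewrite eq1 -mulrA ler_piMl ?(ltW sd1)// divr_ge0// ltW.
have ac : 0 <= decrease_const * chi r k by rewrite mulr_ge0 ?(ltW a0).
apply: ler_pM => //; first by rewrite !le_min ac ler01 (ltW r0).
by rewrite le_min; apply/andP; split; rewrite ge_min ?le2// lexx orbT.
Qed.

End CompatibleIteration.

Lemma incompatible_chi_ge0 k : completed r k -> ~ has_compatible S r k 0 ->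
  theta_at S r k <= delta_n -> 0 <= chi r k.
Proof.
move=> ck nck td; have [_ /(_ nck)[l0 _ chiE _ _]] := iterations ck.
have [v nv _] := normal_bound (completed_reached ck : built S r k 0) td.
rewrite /chi l0 (chiE v nv); apply: crit_measure_ge0 (norm_pb0 k) _.
by case: nv.
Qed.

(** The point is fixed, so theta, being bounded by a multiple of radii that tend to 0, vanishes
    there. *)
Lemma endless_routine k : result r = EndlessRoutine k -> computed S r k 0 ->
  routine_endless S r k ->
  quasi_stationary_subsequence S (fun=> x k) (chis r k) (rads r k).
Proof.
move=> E comp0 endless.
have rk : reached r k by rewrite /reached E.
have /andP[a0 a1] := alpha01; have /andP[r0 rM] := rads_bounds rk.
have M0 : 0 < cM c by have /andP[B0 BM] := cBM; exact: lt_trans BM.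
have radsE j : rads r k j = alpha c ^+ j * rads r k 0.
  elim: j => [|j IH]; first by rewrite mul1r.
  by have [[_ -> _] _] := endless j; rewrite IH exprS mulrA.
have rads0 j : 0 < rads r k j by rewrite radsE mulr_gt0// exprn_gt0.
have radsle j : rads r k j <= rads r k 0.
  by rewrite radsE ler_piMl ?(ltW r0)// exprn_ile1 ?ltW.
have comp j : computed S r k j by case: j => [//|j]; have [] := endless j.
have chis0 j : 0 <= chis r k j.
  have [[lin _] _ _ ->] := comp j; exact: crit_measure_ge0 (norm_pb0 k) lin.
have rads_to0 : rads r k j @[j --> \oo] --> (0 : R).
  rewrite (_ : rads r k = fun j => alpha c ^+ j * rads r k 0); last first.
    by apply/funext => j; exact: radsE.
  rewrite -[0 : R](mul0r (rads r k 0)); apply: cvgMl.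
  by apply: cvg_expr; rewrite ger0_norm// ltW.
(* The routine makes the models of its passes fully linear, starting at index 1; hence the shift. *)
have mk j : local_model k (mods r k j.+1) (rads r k j.+1).
  have [[_ _ fl] _] := endless j; split=> //; first by rewrite ltW ?radsle.
  by move=> i; apply: interpolation; left.
have thle j : theta_at S r k <= grad_const * cc * rads r k j.+1.
  have [[lin _] cmp _ _] := comp j.+1; have [le1 _] := compatible_le (rads0 _) cmp.
  apply: le_trans (theta_le_normal (mk j) lin) _.
  by rewrite -mulrA ler_wpM2l ?(grad_const_ge0 (mk j))//; exact: norm2_step_le le1.
have th0 : theta_at S r k = 0.
  apply/eqP; rewrite eq_le theta_ge0 andbT.
  have lim0 : grad_const * cc * rads r k j.+1 @[j --> \oo] --> (0 : R).
    rewrite -[0 : R](mulr0 (grad_const * cc)); apply: cvgMr.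
    by rewrite (cvg_shiftS (rads r k)).
  rewrite -(cvg_lim _ lim0)//; apply: limr_ge; first by apply/cvg_ex; exists 0.
  by apply: nearW.
exists id, (x k); split => //.
- exact: cvg_cst.
- by split => //; rewrite -[0 : R]th0; exact: cvg_cst.
- apply: (@squeeze_cvgr _ _ _ _ (fun=> 0) (fun j => (cM c)^-1 * rads r k j)).
  + apply: nearW => j /=; rewrite chis0 /= ler_pdivlMl//.
    by have [[/ltW]] := endless j.
  + exact: cvg_cst.
  + by rewrite -[0 : R](mulr0 (cM c)^-1); apply: cvgMr.
Qed.

End LocalModels.

(** * Uniform gradient bounds and the final assembly *)

Section Constants.
Context {R : realType} {n K M P : nat}.
Local Notation V := 'rV[R]_n.
Variables (S : setting R n K M P) (r : run R n K M P).

Lemma reached0 : reached r 0.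
Proof. by rewrite /reached; case: (result r). Qed.

(** A Lipschitz gradient on a bounded set exceeds its value at the initial point by at most [L]
    times the diameter. *)
Lemma bounded_gradients (D : set V) (L : R) : bounded_set D -> domC S r `<=` D ->
  domC S r (pt r 0) -> 0 <= L ->
  (forall i, lip_grad (domC S r) L (component (prob S) i)) ->
  exists G, forall i y, domC S r y -> norm2 (grad (component (prob S) i) y) <= G.
Proof.
move=> [b [breal bD]] CD x0C L0 lip; pose B := `|b| + 1.
have bndD y : D y -> `|y| <= B.
  by apply: bD; rewrite /B (le_lt_trans (ler_norm b))// ltrDl.
pose g0 (i : 'I_K.+1 + 'I_M + 'I_P) : R :=
  norm2 (grad (component (prob S) i) (pt r 0)).
exists (\big[Num.max/0]_i g0 i + L * (n%:R * (B + B))) => i y yC.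
have -> : grad (component (prob S) i) y = grad (component (prob S) i) (pt r 0) +
    (grad (component (prob S) i) y - grad (component (prob S) i) (pt r 0)).
  by rewrite addrC subrK.
apply: le_trans (norm2D _ _) _; apply: lerD; first exact: (le_bigmax _ g0 i).
apply: le_trans (lip i y (pt r 0) yC x0C) _; rewrite ler_wpM2l//.
apply: le_trans (norm2_le_mx_norm _) _; rewrite ler_wpM2l//.
by apply: le_trans (ler_normB _ _) _; rewrite lerD// bndD//; exact: CD.
Qed.

End Constants.

Theorem theorem3 (R : realType) (n K M P : nat)
    (S : setting R n K M P) (r : run R n K M P) (delta_n : R)
    (Hnorms : forall k, is_norm (norm_tr S k) /\ is_norm (norm_pb S k))
    (Hsmooth : smooth_problem S)
    (Hparams : valid_params (par S) delta_n)
    (Hrun : valid_run S r)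
    (Hrestoration : restoration_solver S r)
    (HA1 : A1 S r) (HA2 : A2 S r) (HA3 : A3 S r) (HA4 : A4 S r delta_n)
    (HA5 : A5 S) (HA6 : A6 S r) (HA7 : A7 S r) (HA8 : A8 S r) :
  restoration_fails_at_critical_point S r \/ converges_to_quasi_stationary S r.
Proof.
have [cc cc1 equiv] := HA5; have [D [Dcl Dbd CD]] := HA8.
have [Dmax0 radsb radb] := HA1.
have [flpos _ finalfl [_ lips] interp] := HA3.
have [dn0 [c_ubn ubn0 normal]] := HA4.
have [c_sd [W [sd01 W1 dec]]] := HA7.
have [_ filter0 _ iters outcome_ok] := Hrun.
have flv0 : 0 < fl_val S by have [] := flpos.
have x0C := pt_domC Hnorms cc1 equiv radsb (reached0 r).
have [G0 gradG] : exists G, forall i y, domC S r y ->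
    norm2 (grad (component (prob S) i) y) <= G.
  (* Because of [fl_lip S + Lphi <= fl_val S], the constant [fl_val S] is a common Lipschitz
     constant for all component gradients. *)
  apply: (bounded_gradients Dbd CD x0C (ltW flv0)) => i y z yC zC.
  have [Lphi [_ lip le]] := lips i; apply: le_trans (lip y z yC zC) _.
  by rewrite ler_wpM2r ?norm2_ge0//; have [_ _ L0] := flpos; move: L0 le; lra.
have interp' k j i : built S r k j ->
    component (mods r k j) i (pt r k) = component (prob S) i (pt r k).
  by move=> b; have [] := interp k j i b.
case E : (result r) => [|k y|k].
- right; rewrite /converges_to_quasi_stationary E.
  have ck k : completed r k by rewrite /completed E.
  have rk k : reached r k by rewrite /reached E.
  have G0_ge0 : 0 <= G0.
    by apply: le_trans (gradG (inl (inl ord0)) _ x0C); exact: norm2_ge0.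
  have cc0 : 0 < cc by exact: lt_le_trans cc1.
  have [_ fg0 fL0] := flpos.
  have gc0 : 0 <= grad_const S G0 by rewrite addr_ge0// mulr_ge0// ltW.
  have lc0 : 0 <= lip_const S cc G0.
    by rewrite addr_ge0// mulr_ge0 ?(ltW fL0)// mulr_ge0// ltW.
  have /andP[cD0 _] := c_Delta01 Hparams; have cm0 := c_mu_gt0 Hparams.
  have cDm : 0 <= cc * (c_Delta (par S) * c_mu (par S)) by rewrite !mulr_ge0// ltW.
  have ic0 : 0 <= incompatible_const S c_ubn.
    rewrite divr_ge0 ?(ltW ubn0)// mulr_ge0 ?(ltW cD0)// le_min (ltW cm0) andbT.
    by rewrite invr_ge0 powR_ge0.
  have tc0 := trial_const_ge0 cc flpos.
  pose C1 := grad_const S G0 * (cc * (c_Delta (par S) * c_mu (par S))).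
  pose C2 := trial_const S cc.
  pose C3 := lip_const S cc G0 * (cc * (c_Delta (par S) * c_mu (par S))).
  pose C4 := lip_const S cc G0 * (cc * c_ubn).
  pose C5 := (alpha (par S) `^ (1 + mu (par S)))^-1 * incompatible_const S c_ubn.
  have C10 : 0 <= C1 by rewrite mulr_ge0.
  have C30 : 0 <= C3 by rewrite mulr_ge0.
  have C40 : 0 <= C4 by rewrite mulr_ge0// mulr_ge0// ltW.
  have C50 : 0 <= C5 by rewrite mulr_ge0// invr_ge0 powR_ge0.
  (* The sum of all nonnegative constants dominates each of them; the 1 makes it positive. *)
  pose C := 1 + C1 + C2 + C3 + C4 + C5 + fl_val S + incompatible_const S c_ubn.
  have [CC1 CC2 CC3 CC4 CC5] : [/\ C1 <= C, C2 <= C, C3 <= C, C4 <= C & C5 <= C].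
    by split; rewrite /C; move: tc0; rewrite -/C2; lra.
  have [C0 CC6 CC7] : [/\ 0 < C, fl_val S <= C & incompatible_const S c_ubn <= C].
    by split; rewrite /C; move: tc0; rewrite -/C2; lra.
  have iters' k := iters k (ck k).
  have weaken (c1 s t : R) : c1 <= C -> 0 <= t -> s <= c1 * t -> s <= C * t.
    by move=> cC t0 /le_trans; apply; rewrite ler_wpM2r.
  apply: (@quasi_stationary R n K M P S r delta_n (decrease_const cc c_sd W) C D) => //.
  + exact: bounded_closed_compact.
  + by move=> k; exact: (CD _ (pt_domC Hnorms cc1 equiv radsb (rk k))).
  + move=> i y; have [dphi _ _] := Hsmooth i y I.
    exact: differentiable_continuous.
  + exact: decrease_const_gt0.
  + by move=> k; exact: radb.
  + move=> k kc; apply: weaken CC1 (powR_ge0 _ _) _.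
    exact: (theta_le_rad Hnorms cc1 equiv flpos radsb gradG Hparams radb finalfl
              interp' iters (ck k) kc).
  + move=> k kc; apply: weaken CC2 (sqr_ge0 _) _.
    exact: (theta_xs_le Hnorms cc1 equiv flpos radsb Hparams radb finalfl interp'
              sd01 W1 dec iters (ck k) kc).
  + move=> k kc.
    have nb := norm2_nstep_le_rad cc1 equiv radsb Hparams iters (ck k) kc.
    have := model_decrease_ge_const Hnorms cc1 equiv flpos radsb gradG Hparams
      radb finalfl interp' sd01 W1 dec iters (ck k) kc nb.
    apply: le_trans; rewrite lerD2l lerN2 mulrA ler_wpM2r ?powR_ge0//.
  + move=> k kc td.
    have nb := norm2_nstep_le_theta cc1 equiv normal iters (ck k) kc td.
    have := model_decrease_ge_const Hnorms cc1 equiv flpos radsb gradG Hparams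
      radb finalfl interp' sd01 W1 dec iters (ck k) kc nb.
    apply: le_trans; rewrite lerD2l lerN2 mulrA ler_wpM2r ?theta_ge0//.
  + move=> k kc; apply: weaken CC6 (sqr_ge0 _) _.
    exact: (Phi_xs_dist Hnorms cc1 equiv radsb Hparams radb finalfl interp'
              sd01 W1 dec iters (ck k) kc).
  + move=> k kc td; apply: weaken CC7 (theta_ge0 _ _) _.
    apply: (incompatible_radius Hparams normal (rk k : built S r k 0) _ td kc).
    by have /andP[-> /ltW ->] := radsb k (rk k).
  + by move=> k kc; exact: (rad_ge_chi iters (ck k) kc).
  + move=> k; have [kc _|nkc [//|td]] := pselect (has_compatible S r k 0).
      exact: (chi_ge0 Hnorms iters (ck k) kc).
    exact: (incompatible_chi_ge0 Hnorms normal iters (ck k) nkc td).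
  + move=> k kc te ce.
    have [le|le] := final_radius_small Hnorms radsb Hparams normal iters (ck k) kc te ce.
      by left.
    by right; apply: weaken CC5 (theta_ge0 _ _) le.
- by left; exists k, y; split => //; exact: Hrestoration E.
- right; rewrite /converges_to_quasi_stationary E.
  move: outcome_ok; rewrite E => -[_ comp0 _ endless].
  exact: (endless_routine Hnorms cc1 equiv flpos radsb gradG Hparams interp'
            E comp0 endless).
Qed.
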